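(* There are absolute constants $c,\eta>0$ such that for every prime $p$, all $\alpha,\beta,\gamma,\delta\in\mathbb F_p^\times$ with $\alpha\delta-\beta\gamma\ne0$, and every $V\subseteq\mathbb F_p^\times$, $$|V|\ge c\,\min\{\mathcal N_T(V),p\}^{1/2+\eta},$$ where $$\mathcal N_T(V)=\#\{(x,a)\in V^2:\ \gamma a+\delta x\ne0,\ T_a(x)\in V\},\qquad T_a(x)=a\,\frac{\alpha a+\beta x}{\gamma a+\delta x}.$$ *)

(* Defs.v *)
From HB Require Import structures.
From mathcomp Require Import all_boot all_order all_algebra.
From mathcomp Require Import reals exp.

Set Implicit Arguments.
Unset Strict Implicit.
Unset Printing Implicit Defensive.

Import Order.TTheory GRing.Theory Num.Theory.
Local Open Scope ring_scope.

(* When gamma * a + delta * x = 0 the inverse is 0 by convention; this junk value is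
   excluded in [NT]. *)
Definition Tmap (F : finFieldType) (alpha beta gamma delta a x : F) : F :=
  a * ((alpha * a + beta * x) / (gamma * a + delta * x)).

Definition NT (F : finFieldType) (alpha beta gamma delta : F) (V : {set F})
    : nat :=
  #|[set xa : F * F | [&& xa.1 \in V, xa.2 \in V,
       gamma * xa.2 + delta * xa.1 != 0
     & Tmap alpha beta gamma delta xa.2 xa.1 \in V]]|.

(* Main.v *)
(* Let n = |V| and suppose NT >= n^2 / K. Every T_a is a Moebius map, and the
   composition T_c T_b^-1 T_a determines (a, b, c) up to four choices, away
   from a lower-dimensional set of labels. Counting walks of length three thus
   yields n^3 / K^O(1) distinct Moebius maps, each sending n / K^O(1) points of
   a dilate X of V into a dilate Y of V. Fix a popular pair x0 -> y0 and send
   both points to infinity: the maps become affine, and such a map is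
   determined by the images u, v of two further points z0, z1, a point z with
   parameter l being sent to (1 - l) u + l v. Hence a set W of size at most n
   satisfies (1 - l) u + l v \in W for n^3 / K^O(1) triples (l, u, v), with u, v
   in W and l in a set of size at most n. By the Balog-Szemeredi-Gowers lemma
   and the Ruzsa and Plunnecke-Petridis inequalities there is A of size
   n / K^O(1) such that n / K^O(1) elements x of F_p satisfy |A + x A| <= K^O(1) n.
   The x with this property are stable under a bounded number of ring
   operations, which makes them too numerous (a second-moment count allows only
   K^O(1) n of them) unless n <= K^O(1) or p <= K^O(1) n. *)
Require Import Defs.
From HB Require Import structures.
From mathcomp Require Import all_boot all_order all_algebra.
From mathcomp Require Import reals exp.
From mathcomp Require Import zify ring.

Set Implicit Arguments.
Unset Strict Implicit.
Unset Printing Implicit Defensive.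

Import Order.TTheory GRing.Theory Num.Theory.

(** * Counting and the Balog-Szemeredi-Gowers lemma *)

Lemma card_sum_bool (I : finType) (P : {set I}) (q : pred I) :
  #|[set i in P | q i]| = \sum_(i in P) (q i : nat).
Proof.
rewrite -sum1_card big_mkcond [RHS]big_mkcond.
by apply: eq_bigr => i _; rewrite inE; case: (i \in P) (q i) => [] [].
Qed.

Lemma sum_sq_le (I : finType) (P : {set I}) (f : I -> nat) :
  (\sum_(i in P) f i) ^ 2 <= #|P| * \sum_(i in P) f i ^ 2.
Proof.
rewrite -(leq_pmul2l (isT : 0 < 2)).
rewrite -[X in 2 * X]mulnn big_distrlr /= big_distrr /=.
apply: (@leq_trans (\sum_(i in P) \sum_(j in P) (f i ^ 2 + f j ^ 2))).
  apply: leq_sum => i _; rewrite big_distrr /=; apply: leq_sum => j _.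
  exact: nat_Cauchy.
under eq_bigr => i _ do rewrite big_split /= sum_nat_const.
rewrite big_split /= sum_nat_const -big_distrr /=.
by rewrite addnn -mul2n.
Qed.

(** Cauchy-Schwarz for the fibre sizes of [f], whose squares add up to the number of colliding
    pairs. *)
Lemma card_fibre_pairs (T S : finType) (D : {set T}) (f : T -> S) (Q : {set S}) :
  (forall t, t \in D -> f t \in Q) ->
  #|D| ^ 2 <= #|Q| * #|[set u in setX D D | f u.1 == f u.2]|.
Proof.
move=> fQ.
have -> : #|D| = \sum_(s in Q) #|[set t in D | f t == s]|.
  rewrite -sum1_card (partition_big f (mem Q)) //=.
  apply: eq_bigr => s _; rewrite -sum1_card.
  by apply: eq_bigl => t; rewrite inE.
apply: leq_trans (sum_sq_le _ _) _; rewrite leq_mul2l; apply/orP; right.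
rewrite -[X in _ <= X]sum1_card (partition_big (fun u : T * T => f u.1) (mem Q)) /=; last first.
  by move=> [a b]; rewrite !inE /= => /andP[/andP[/fQ]].
apply: leq_sum => s _; rewrite -mulnn -cardsX -sum1_card.
rewrite big_mkcond [leqRHS]big_mkcond /=; apply: leq_sum => -[a b] _.
rewrite !inE /=; case: (a \in D) (b \in D) => [] [] //=.
  by case: eqP => //= ->; rewrite eq_sym andbT.
by rewrite andbF.
Qed.

Lemma pigeonhole_sum (I : finType) (P : {set I}) (f : I -> nat) (m n : nat) :
  0 < m -> #|P| <= n -> m <= \sum_(i in P) f i -> exists2 i, i \in P & m <= n * f i.
Proof.
move=> m0 Pn le; apply/exists_inP; apply: contraLR le.
rewrite negb_exists_in -ltnNge => /forall_inP h.
have [->|[i0 i0P]] := set_0Vmem P; first by rewrite big_set0.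
have n0 : 0 < n by apply: leq_trans Pn; apply/card_gt0P; exists i0.
rewrite -(ltn_pmul2l n0) big_distrr /=.
apply: (@leq_trans (\sum_(i in P) m.-1).+1).
  by rewrite ltnS; apply: leq_sum => i /h; lia.
by rewrite sum_nat_const; nia.
Qed.

(** An unpopular term has [c * f i < t], so all of them together cost at most [#|P| * t]. In the
    uses this is at most half of the left side, and the popular terms keep a positive proportion of
    the sum. *)
Lemma sum_popular (I : finType) (P : {set I}) (f : I -> nat) (c t : nat) :
  c * \sum_(i in P) f i
    <= c * (\sum_(i in [set i in P | t <= c * f i]) f i) + #|P| * t.
Proof.
rewrite !big_distrr /= -sum_nat_const.
rewrite [X in _ <= X + _]big_mkcond [X in _ <= _ + X]big_mkcond.
rewrite [X in X <= _]big_mkcond -big_split /=.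
apply: leq_sum => i _; rewrite inE; case: (i \in P) => //=.
by case: (leqP t (c * f i)) => h; [exact: leq_addr | exact: ltnW].
Qed.

Section BalogSzemerediGowers.
Variables (I J : finType) (X : {set I}) (Y : {set J}) (e : I -> J -> bool).

(** The paths [a - y - x - b] in the bipartite graph [e], recorded by their inner vertices
    [(x, y)]. *)
Definition paths3 (a : I) (b : J) : {set I * J} :=
  [set u in setX X Y | [&& e a u.2, e u.1 u.2 & e u.1 b]].

(** Call a pair in [X] bad if it has few common neighbours. Averaging yields a vertex [y0] whose
    neighbourhood [N0] is large and contains few bad pairs. Let [A] be the points of [N0] with few
    bad partners there, and [B] the vertices with many neighbours in [N0]. For [a] in [A] and [b] in
    [B], at least half of the neighbours of [b] in [N0] form a good pair with [a], and each of them
    gives many paths. *)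
Lemma balog_szemeredi_gowers_regular (n K : nat) :
  0 < n -> 0 < K -> #|X| <= n -> #|Y| <= n ->
  n ^ 2 <= K * \sum_(x in X) #|[set y in Y | e x y]| ->
  (forall x, x \in X -> n <= K * #|[set y in Y | e x y]|) ->
  exists (A : {set I}) (B : {set J}), [/\ A \subset X, B \subset Y, n <= 4 * K * #|A|, n <= 2 * K * #|B|
    & forall a b, a \in A -> b \in B -> n ^ 2 <= 128 * K ^ 5 * #|paths3 a b|].
Proof.
move=> n0 K0 Xn Yn edges deg.
pose N y := [set x in X | e x y].
pose cod x x' := #|[set y in Y | e x y && e x' y]|.
(* A point of [A] will have at most [2 * #|N0| / L = #|N0| / (4 * K)] bad partners, half of the
   [#|N0| / (2 * K)] neighbours in [N0] guaranteed to a point of [B]. *)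
pose L := 8 * K.
pose bad x x' := cod x x' * (2 * L * K ^ 2) < n.
pose beta y := \sum_(x in N y) \sum_(x' in N y) (bad x x' : nat).
have sumN (Z : {set I}) : Z \subset X ->
    \sum_(x in Z) #|[set y in Y | e x y]| = \sum_(y in Y) #|Z :&: N y|.
  move=> ZX; under eq_bigr => x _ do rewrite card_sum_bool.
  rewrite exchange_big /=; apply: eq_bigr => y _.
  rewrite -card_sum_bool; apply: eq_card => x; rewrite !inE.
  by case: (boolP (x \in Z)) => //= /(subsetP ZX) ->.
have sumN2 : n ^ 3 <= K ^ 2 * \sum_(y in Y) #|N y| ^ 2.
  rewrite -(leq_pmul2l n0).
  have h : \sum_(x in X) #|[set y in Y | e x y]| = \sum_(y in Y) #|N y|.
    rewrite sumN //; apply: eq_bigr => y _; congr #|pred_of_set _|.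
    by apply/setIidPr/subsetP => x; rewrite inE => /andP[].
  rewrite h in edges.
  have := sum_sq_le Y (fun y => #|N y|).
  set S := (\sum_(y in Y) #|N y|) in edges *; set S2 := (\sum_(y in Y) #|N y| ^ 2).
  move=> cs; have h1 : (n ^ 2) ^ 2 <= (K * S) ^ 2 by rewrite leq_sqr.
  have h2 : #|Y| * S2 <= n * S2 by rewrite leq_mul2r Yn orbT.
  have h3 : (K * S) ^ 2 <= K ^ 2 * (n * S2).
    by rewrite expnMn leq_mul2l (leq_trans cs h2) orbT.
  have -> : n * n ^ 3 = (n ^ 2) ^ 2 by rewrite -expnS -expnM.
  by apply: leq_trans h1 (leq_trans h3 _); rewrite mulnCA.
have sumbeta : 2 * L * K ^ 2 * \sum_(y in Y) beta y <= n ^ 3.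
  have -> : \sum_(y in Y) beta y = \sum_(x in X) \sum_(x' in X) bad x x' * cod x x'.
    rewrite /beta; under eq_bigr => y _.
      rewrite big_mkcond /=.
      under eq_bigr => x _ do rewrite big_mkcond /=.
      over.
    rewrite exchange_big [RHS]big_mkcond /=; apply: eq_bigr => x _.
    case: (boolP (x \in X)) => xX; last first.
      by apply: big1 => y _; rewrite inE (negbTE xX).
    under eq_bigr => y _ do rewrite inE xX /=.
    rewrite [RHS]big_mkcond /= -big_mkcondr exchange_big /=; apply: eq_bigr => x' _.
    case: (boolP (x' \in X)) => x'X; last first.
      by apply: big1 => y _; rewrite inE (negbTE x'X).
    rewrite /cod card_sum_bool big_distrr /= big_mkcondr; apply: eq_bigr => y _.
    by rewrite inE x'X /=; case: (e x y) (e x' y) (bad x x') => [] [] [].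
  rewrite big_distrr /=; apply: (@leq_trans (\sum_(x in X) n ^ 2)); last first.
    by rewrite sum_nat_const expnS leq_mul2r Xn orbT.
  apply: leq_sum => x _; rewrite big_distrr /=.
  apply: (@leq_trans (\sum_(x' in X) n)); last first.
    by rewrite sum_nat_const -mulnn leq_mul2r Xn orbT.
  apply: leq_sum => x' _; case: (boolP (bad x x')); last by rewrite mul0n muln0.
  by rewrite /bad mul1n mulnC => /ltnW.
(* Summed over [Y], the left side is at most [2 * n ^ 3] and the right side at least that. A single
   inequality thus secures both that [N y0] is large and that it has few bad pairs. *)
have [y0 y0Y hy0] : exists2 y, y \in Y &
    n ^ 2 + 2 * L * K ^ 2 * beta y <= 2 * K ^ 2 * #|N y| ^ 2.
  apply/exists_inP; apply: contraT; rewrite negb_exists_in => /forall_inP h.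
  have : \sum_(y in Y) (2 * K ^ 2 * #|N y| ^ 2).+1
      <= \sum_(y in Y) (n ^ 2 + 2 * L * K ^ 2 * beta y).
    by apply: leq_sum => y /h; rewrite -ltnNge.
  under eq_bigr => y _ do rewrite -addn1.
  rewrite !big_split /= !sum_nat_const -!big_distrr /= => h1.
  have Y0 : 0 < #|Y|.
    rewrite lt0n; apply: contraTneq sumN2 => /cards0_eq ->.
    by rewrite big_set0 muln0 -ltnNge expn_gt0 n0.
  move: h1 sumN2 sumbeta.
  set S2 := (\sum_(y in Y) #|N y| ^ 2); set Sb := (\sum_(y in Y) beta y).
  have : #|Y| * n ^ 2 <= n ^ 3 by rewrite expnS leq_mul2r Yn orbT.
  rewrite -!mulnA; lia.
pose N0 := N y0.
have N0X : N0 \subset X by apply/subsetP => x; rewrite inE => /andP[].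
have nN0 : n <= 2 * K * #|N0|.
  rewrite -leq_sqr; apply: leq_trans (leq_trans (leq_addr _ _) hy0) _.
  by rewrite !expnMn -/N0; lia.
have N00 : 0 < #|N0| by rewrite lt0n; apply: contraTneq nN0 => ->; lia.
have betaN0 : L * beta y0 <= #|N0| ^ 2.
  have K2 : 0 < 2 * K ^ 2 by rewrite muln_gt0 expn_gt0 K0.
  rewrite -(leq_pmul2l K2); apply: leq_trans (leq_trans (leq_addl _ _) hy0).
  by rewrite mulnA [2 * K ^ 2 * L]mulnAC.
pose nb x := #|[set x' in N0 | bad x x']|.
pose A := [set x in N0 | L * nb x <= 2 * #|N0|].
pose B := [set y in Y | #|N0| <= 2 * K * #|N0 :&: N y|].
exists A, B; split.
- by apply/subsetP => x; rewrite inE => /andP[/(subsetP N0X)].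
- by apply/subsetP => x; rewrite inE => /andP[].
- have h : 2 * #|N0| * #|N0 :\: A| <= #|N0| ^ 2.
    apply: leq_trans betaN0; rewrite /beta big_distrr /= -/N0.
    rewrite mulnC -sum_nat_const.
    rewrite big_mkcond [leqRHS]big_mkcond /=; apply: leq_sum => x _.
    rewrite in_setD in_set; case: (x \in N0); rewrite ?andbF //= andbT.
    by rewrite -card_sum_bool -/(nb x) -ltnNge; case: ifP => // /ltnW.
  have AN0 : A \subset N0 by apply/subsetP => x; rewrite inE => /andP[].
  have := cardsD N0 A; rewrite (setIidPr AN0) => hD.
  have := subset_leq_card AN0.
  have {h} : 2 * #|N0 :\: A| <= #|N0|.
    by rewrite -(leq_pmul2l N00) mulnn; apply: leq_trans h; rewrite mulnCA mulnA.
  by move: nN0; rewrite -mulnA; nia.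
- have := sum_popular Y (fun y => #|N0 :&: N y|) (2 * K) #|N0|.
  rewrite -/B -sumN //.
  have h1 : #|N0| * n <= K * \sum_(x in N0) #|[set y in Y | e x y]|.
    by rewrite big_distrr /= -sum_nat_const; apply: leq_sum => x /(subsetP N0X)/deg.
  have h2 : \sum_(y in B) #|N0 :&: N y| <= #|B| * #|N0|.
    by rewrite -sum_nat_const; apply: leq_sum => y _; apply: subset_leq_card (subsetIl _ _).
  have h3 : #|Y| * #|N0| <= n * #|N0| by rewrite leq_mul2r Yn orbT.
  have h4 : 2 * K * \sum_(y in B) #|N0 :&: N y| <= 2 * K * (#|B| * #|N0|) by rewrite leq_mul2l h2 orbT.
  move=> h5; rewrite -(leq_pmul2l N00); lia.
- move=> a b; rewrite !inE => /andP[/andP[aX _]] aL /andP[bY bN].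
  pose G1 := [set x in N0 :&: N b | ~~ bad a x].
  have hG : #|N0 :&: N b| <= #|G1| + nb a.
    rewrite -(cardsID [set x | bad a x] (N0 :&: N b)) addnC; apply: leq_add.
      by apply: subset_leq_card; apply/subsetP => x; rewrite !inE; lia.
    by apply: subset_leq_card; apply/subsetP => x; rewrite !inE => /andP[/andP[->]] _ ->.
  have hG2 : #|N0 :&: N b| <= 2 * #|G1|.
    suff : 2 * nb a <= #|N0 :&: N b| by lia.
    by rewrite -(leq_pmul2l K0); move: aL bN; rewrite /L; lia.
  have hG3 : n <= 8 * K ^ 2 * #|G1|.
    apply: leq_trans nN0 _; rewrite -!mulnn.
    by apply: (@leq_trans (2 * K * (2 * K * (2 * #|G1|)))); [nia|lia].
  have -> : #|paths3 a b| = \sum_(x in X) \sum_(y in Y) ([&& e a y, e x y & e x b] : nat).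
    by rewrite pair_big /= /paths3 card_sum_bool; apply: eq_bigl => -[x y]; rewrite in_setX.
  apply: (@leq_trans (128 * K ^ 5 * \sum_(x in G1) cod a x)); last first.
    rewrite leq_mul2l; apply/orP; right; rewrite big_mkcond [leqRHS]big_mkcond.
    apply: leq_sum => x _; rewrite !inE.
    case: (x \in X) => //=; case: (e x b); rewrite ?andbF //= andbT.
    rewrite /cod card_sum_bool; case: ifP => // _; apply: leq_sum => y _.
    by rewrite andbT.
  have : #|G1| * n <= 16 * K ^ 3 * \sum_(x in G1) cod a x.
    rewrite big_distrr /= -sum_nat_const; apply: leq_sum => x.
    by rewrite inE /bad -leqNgt => /andP[_]; rewrite /L !expnS expn0; lia.
  move: hG3; rewrite -mulnn; move: (\sum_(x in _) _) #|G1| => S g h1 h2.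
  apply: (@leq_trans (8 * K ^ 2 * g * n)); first by rewrite leq_mul2r h1 orbT.
  apply: (@leq_trans (8 * K ^ 2 * (16 * K ^ 3 * S))).
    by rewrite -mulnA leq_mul2l h2 orbT.
  by rewrite !expnS expn0; lia.
Qed.

End BalogSzemerediGowers.

(** Discarding the vertices of degree below [n / (2 * K)] loses at most half of the edges, so the
    regular case applies with [2 * K] for [K]. *)
Lemma balog_szemeredi_gowers (I J : finType) (X : {set I}) (Y : {set J})
    (e : I -> J -> bool) (n K : nat) :
  0 < n -> 0 < K -> #|X| <= n -> #|Y| <= n ->
  n ^ 2 <= K * \sum_(x in X) #|[set y in Y | e x y]| ->
  exists (A : {set I}) (B : {set J}),
    [/\ A \subset X, B \subset Y, n <= 8 * K * #|A|, n <= 4 * K * #|B|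
    & forall a b, a \in A -> b \in B ->
        n ^ 2 <= 4096 * K ^ 5 * #|paths3 X Y e a b|].
Proof.
move=> n0 K0 Xn Yn edges.
pose d x := #|[set y in Y | e x y]|; pose X1 := [set x in X | n <= 2 * K * d x].
have X1X : X1 \subset X by apply/subsetP => x; rewrite inE => /andP[].
have edges1 : n ^ 2 <= 2 * K * \sum_(x in X1) d x.
  have := sum_popular X d (2 * K) n; rewrite -/X1 => h.
  have h1 : #|X| * n <= n ^ 2 by rewrite -mulnn leq_mul2r Xn orbT.
  move: edges h h1; rewrite -/d -!mulnA.
  by move: (K * \sum_(x in X) _) (K * \sum_(x in X1) _) (_ * n) (n ^ 2) => *; lia.
have [|x|A [B [AX BY nA nB hp]]] := balog_szemeredi_gowers_regular n0 _
    (leq_trans (subset_leq_card X1X) Xn) Yn edges1.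
- by rewrite muln_gt0.
- by rewrite inE => /andP[].
exists A, B; split=> //.
- exact: subset_trans X1X.
- by rewrite mulnA in nA.
- by rewrite mulnA in nB.
move=> a b /hp h /h {}h; apply: leq_trans h _; rewrite expnMn mulnA leq_mul2l.
apply/orP; right; apply: subset_leq_card; apply/subsetP => u.
by rewrite !inE => /andP[/andP[/andP[-> _] ->]].
Qed.

Lemma sum_card_disjoint (I T : finType) (S : {set I}) (P : I -> {set T}) (Q : {set T}) :
  (forall s, s \in S -> P s \subset Q) ->
  (forall s s' t, s \in S -> s' \in S -> t \in P s -> t \in P s' -> s = s') ->
  \sum_(s in S) #|P s| <= #|Q|.
Proof.
move=> PQ disj.
have -> : \sum_(s in S) #|P s| = \sum_(t in Q) #|[set s in S | t \in P s]|.
  under [RHS]eq_bigr => t _ do rewrite card_sum_bool.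
  rewrite exchange_big /=; apply: eq_bigr => s sS; rewrite -card_sum_bool.
  apply: eq_card => t; rewrite inE; case: (boolP (t \in P s)); rewrite ?andbF // andbT.
  by move/(subsetP (PQ s sS)) ->.
rewrite -sum1_card; apply: leq_sum => t _; apply/card_le1_eqP => s s'.
by rewrite !inE => /andP[sS ts] /andP[s'S ts']; apply: (disj _ _ t).
Qed.

(** By Cauchy-Schwarz on the multiplicities [r t], the pairwise intersections have average size at
    least [q / c ^ 2]. Some [j] attains this average, and the popular [i] for this [j] form the
    required set. *)
Lemma dense_family_intersection (I T : finType) (P : {set I}) (D : I -> {set T})
    (Q : {set T}) (c q : nat) :
  0 < q -> #|Q| <= q -> P != set0 -> (forall i, i \in P -> D i \subset Q) ->
  (forall i, i \in P -> q <= c * #|D i|) ->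
  exists2 j, j \in P &
    #|P| <= 2 * c ^ 2 * #|[set i in P | q <= 2 * c ^ 2 * #|D i :&: D j|]|.
Proof.
move=> q0 Qq P0 DQ qD.
pose r t := #|[set i in P | t \in D i]|.
have sum_r : \sum_(t in Q) r t = \sum_(i in P) #|D i|.
  under eq_bigr => t _ do rewrite /r card_sum_bool.
  rewrite exchange_big /=; apply: eq_bigr => i iP; rewrite -card_sum_bool.
  by apply: eq_card => t; rewrite inE andb_idl // => /(subsetP (DQ i iP)).
have sum_r2 : \sum_(t in Q) r t ^ 2 = \sum_(j in P) \sum_(i in P) #|D i :&: D j|.
  under eq_bigr => t _ do rewrite -mulnn /r card_sum_bool big_distrlr /=.
  rewrite exchange_big /=; apply: eq_bigr => j jP.
  rewrite exchange_big /=; apply: eq_bigr => i iP.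
  under eq_bigr => t _ do rewrite mulnb.
  rewrite -card_sum_bool; apply: eq_card => t; rewrite !inE.
  by rewrite [RHS]andbC andb_idl // => /andP[/(subsetP (DQ j jP))].
have big : #|P| * (#|P| * q) <= \sum_(j in P) c ^ 2 * \sum_(i in P) #|D i :&: D j|.
  rewrite -big_distrr /= -sum_r2 -(leq_pmul2r q0).
  have h1 : #|P| * q <= c * \sum_(t in Q) r t.
    by rewrite sum_r big_distrr /= -sum_nat_const; apply: leq_sum.
  have h2 : (#|P| * q) ^ 2 <= c ^ 2 * (q * \sum_(t in Q) r t ^ 2).
    apply: (@leq_trans ((c * \sum_(t in Q) r t) ^ 2)); first by rewrite leq_sqr.
    rewrite expnMn leq_mul2l; apply/orP; right.
    by apply: leq_trans (sum_sq_le _ _) _; rewrite leq_mul2r Qq orbT.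
  by rewrite mulnAC mulnn -mulnA [_ * q in leqRHS]mulnC.
have P1 : 0 < #|P| by rewrite card_gt0.
have PPq : 0 < #|P| * (#|P| * q) by rewrite !muln_gt0 P1.
have [j jP hj] := pigeonhole_sum PPq (leqnn #|P|) big.
exists j => //; set M := [set i in P | _].
have := sum_popular P (fun i => #|D i :&: D j|) (2 * c ^ 2) q; rewrite -/M.
have : \sum_(i in M) #|D i :&: D j| <= #|M| * q.
  rewrite -sum_nat_const; apply: leq_sum => i; rewrite inE => /andP[iP _].
  by apply: leq_trans Qq; apply: subset_leq_card; apply: subset_trans (DQ i iP); apply: subsetIl.
move: hj; rewrite leq_pmul2l // -mulnA.
move: (\sum_(i in P) _) (\sum_(i in M) _) => S1 S2 h1 h2 h3.
have h4 : 2 * c ^ 2 * S2 <= 2 * c ^ 2 * (#|M| * q) by rewrite leq_mul2l h2 orbT.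
rewrite -(leq_pmul2r q0).
rewrite -mulnn -!mulnA in h1 h3 h4 *; move: h1 h3 h4.
move: (c * (c * S1)) (c * (c * S2)) (c * (c * (#|M| * q))) (#|P| * q); lia.
Qed.

Lemma card_le_fibres (T S : finType) (D : {set T}) (f : T -> S) (c : nat) :
  (forall s, #|[set t in D | f t == s]| <= c) -> #|D| <= c * #|f @: D|.
Proof.
move=> fc; rewrite -[#|D|]sum1_card (partition_big f (mem (f @: D))) /=; last first.
  by move=> t tD; apply: imset_f.
rewrite mulnC -sum_nat_const; apply: leq_sum => s _; apply: leq_trans (fc s).
by rewrite -sum1_card; apply: eq_leq; apply: eq_bigl => t; rewrite inE.
Qed.

(** A light fibre has at most [d i < n / c] elements, and there are at most [#|Q|] fibres. *)
Lemma card_light (T I : finType) (E : {set T}) (f : T -> I) (Q : {set I})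
    (d : I -> nat) (c n : nat) :
  (forall e, e \in E -> f e \in Q) ->
  (forall i, #|[set e in E | f e == i]| <= d i) ->
  c * #|[set e in E | c * d (f e) < n]| <= #|Q| * n.
Proof.
move=> fQ fd; rewrite -[X in c * X]sum1_card (partition_big f (mem Q)) /=; last first.
  by move=> e; rewrite inE => /andP[/fQ].
rewrite big_distrr -sum_nat_const; apply: leq_sum => i _ /=.
have [lt|le] := ltnP (c * d i) n; last first.
  rewrite big1 ?muln0 // => e; rewrite inE => /andP[/andP[_ +] /eqP fe].
  by rewrite fe ltnNge le.
apply: leq_trans (ltnW lt); rewrite leq_mul2l; apply/orP; right.
apply: leq_trans (fd i); rewrite sum1dep_card; apply: subset_leq_card.
by apply/subsetP => e; rewrite !inE => /andP[/andP[-> _] ->].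
Qed.

(** Double count the incidences [x \in S i] with [x] outside [Z], then average over the at most [n]
    points of [X :\: Z]. *)
Lemma select_point (I T : finType) (P : {set I}) (S : I -> {set T}) (X Z : {set T})
    (c n : nat) :
  0 < n -> #|X| <= n -> P != set0 ->
  (forall i, i \in P -> S i \subset X /\ n <= c * #|S i :\: Z|) ->
  exists x, x \in X :\: Z /\ #|P| <= c * #|[set i in P | x \in S i]|.
Proof.
move=> n0 Xn P0 hS.
have le : #|P| * n <= \sum_(x in X :\: Z) c * #|[set i in P | x \in S i]|.
  rewrite -big_distrr /=; under eq_bigr => x _ do rewrite card_sum_bool.
  rewrite exchange_big big_distrr -sum_nat_const /=; apply: leq_sum => i /hS[SX ni].
  rewrite -card_sum_bool; apply: leq_trans ni _; rewrite leq_mul2l; apply/orP; right.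
  apply: subset_leq_card; apply/subsetP => x; rewrite !inE => /andP[-> xS].
  by rewrite xS (subsetP SX).
have Pn : 0 < #|P| * n by rewrite muln_gt0 card_gt0 P0.
have XZn : #|X :\: Z| <= n by apply: leq_trans (subset_leq_card (subsetDl _ _)) Xn.
have [x xX] := pigeonhole_sum Pn XZn le.
by rewrite [#|P| * n]mulnC leq_pmul2l // => ?; exists x.
Qed.

(** * Sumsets *)

Local Open Scope ring_scope.

Definition sumset (F : finFieldType) (A B : {set F}) : {set F} :=
  [set x + y | x in A, y in B].
Definition dilate (F : finFieldType) (c : F) (A : {set F}) : {set F} :=
  [set c * x | x in A].
Local Notation "A <+> B" := (sumset A B) (at level 50, left associativity).

Section Sumsets.
Variable F : finFieldType.
Implicit Types (A B C X Y U V : {set F}) (x y c : F).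

Lemma sumsetP A B z :
  reflect (exists x y, [/\ x \in A, y \in B & z = x + y]) (z \in A <+> B).
Proof.
apply: (iffP imset2P) => [[x y ? ? ?]|[x [y [? ? ?]]]]; last by exists x y.
by exists x, y.
Qed.

Lemma mem_sumset A B x y : x \in A -> y \in B -> x + y \in A <+> B.
Proof. by move=> xA yB; apply/sumsetP; exists x, y. Qed.

Lemma mem_dilate c A x : x \in A -> c * x \in dilate c A.
Proof. exact: imset_f. Qed.

Lemma sumsetC A B : A <+> B = B <+> A.
Proof.
by apply/setP => z; apply/sumsetP/sumsetP => -[x [y [? ? ->]]];
  exists y, x; rewrite addrC.
Qed.

Lemma sumsetA A B C : A <+> (B <+> C) = A <+> B <+> C.
Proof.
apply/setP => z; apply/sumsetP/sumsetP.
  move=> [x [_ [xA /sumsetP[y [w [yB wC ->]]] ->]]].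
  by exists (x + y), w; rewrite mem_sumset // addrA.
move=> [_ [w [/sumsetP[x [y [xA yB ->]]] wC ->]]].
by exists x, (y + w); rewrite mem_sumset // addrA.
Qed.

Lemma sumsetS A B A' B' : A \subset A' -> B \subset B' -> A <+> B \subset A' <+> B'.
Proof.
move=> /subsetP AA' /subsetP BB'; apply/subsetP => _ /sumsetP[x [y [xA yB ->]]].
by rewrite mem_sumset ?AA' ?BB'.
Qed.

Lemma card_sumset_le A B : (#|A <+> B| <= #|A| * #|B|)%N.
Proof. by rewrite /sumset curry_imset2X -cardsX leq_imset_card. Qed.

Lemma card_dilate_le c A : (#|dilate c A| <= #|A|)%N.
Proof. exact: leq_imset_card. Qed.

Lemma card_dilate c A : c != 0 -> #|dilate c A| = #|A|.
Proof. by move=> c0; apply: card_imset; apply: mulfI. Qed.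

(** Fix a representation [d = u - v] of each difference. The map from [(d, x)] to [(u + x, v + x)]
    is injective, because subtracting the coordinates returns [d]. *)
Lemma ruzsa_triangle U V X :
  (#|U <+> dilate (-1)%R V| * #|X| <= #|U <+> X| * #|V <+> X|)%N.
Proof.
pose rep d := odflt (0, 0) [pick u in setX U V | u.1 - u.2 == d].
have repP d : d \in U <+> dilate (-1) V ->
    [/\ (rep d).1 \in U, (rep d).2 \in V & (rep d).1 - (rep d).2 = d].
  move=> /sumsetP[u [_ [uU /imsetP[v vV ->] ->]]]; rewrite /rep.
  case: pickP => /= [[a b]|/(_ (u, v))]; rewrite !inE.
    by move=> /andP[/andP[? ?] /eqP].
  by rewrite uU vV mulN1r eqxx.
pose P d := [set ((rep d).1 + x, (rep d).2 + x) | x in X].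
have cP d : #|P d| = #|X| by rewrite card_imset // => x y [/addrI].
rewrite -[leqRHS]cardsX -sum_nat_const.
apply: (@leq_trans (\sum_(d in U <+> dilate (-1)%R V) #|P d|)%N).
  by apply: leq_sum => d _; rewrite cP.
apply: sum_card_disjoint.
  move=> d /repP[dU dV _]; apply/subsetP => _ /imsetP[x xX ->].
  by rewrite inE !mem_sumset.
move=> d d' t /repP[_ _ e] /repP[_ _ e'] /imsetP[x _ ->] /imsetP[y _ [h1 h2]].
by rewrite -e -e' -(addrK x (rep d).1) h1 -(addrK x (rep d).2) h2; ring.
Qed.

(** Take [T] maximal with the translates [t + B] disjoint. By maximality every [a + B] with [a] in
    [A] meets some [t + B], which puts [a] in [t + B - B]. *)
Lemma ruzsa_covering A B : B != set0 ->
  exists T : {set F}, [/\ T \subset A, (#|T| * #|B| <= #|A <+> B|)%N &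
    A \subset T <+> (B <+> dilate (-1) B)].
Proof.
move=> /set0Pn[b0 b0B].
(* The equality of cardinals encodes disjointness of the translates of [B]. *)
pose P (T : {set F}) := (T \subset A) && (#|T <+> B| == #|T| * #|B|)%N.
have P0 : P set0.
  rewrite /P sub0set cards0 mul0n cards_eq0; apply/eqP/setP => z; rewrite inE.
  by apply/negbTE/sumsetP => -[x [y []]]; rewrite inE.
case: (arg_maxnP (fun T : {set F} => #|T|) P0) => T /andP[TA /eqP TB] maxT.
exists T; split => //; first by rewrite -TB subset_leq_card // sumsetS.
apply/subsetP => a aA; have [aT|aT] := boolP (a \in T).
  by rewrite -[a]addr0 -(subrr b0) mem_sumset // mem_sumset // -[- b0]mulN1r mem_dilate.
have [/eqP dis|] := boolP ((set1 a <+> B) :&: (T <+> B) == set0); last first.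
  move=> /set0Pn[z]; rewrite inE => /andP[/sumsetP[x [b [/set1P-> bB ->]]]].
  move=> /sumsetP[t [b' [tT b'B h]]].
  have -> : a = t + (b' + -1 * b) by rewrite mulN1r addrA -h addrK.
  by rewrite mem_sumset // mem_sumset // mem_dilate.
suff /maxT : P (a |: T) by rewrite /= cardsU1 aT add1n leqNgt ltnS leqnn.
rewrite /P subUset sub1set aA TA /=.
have -> : (a |: T) <+> B = (set1 a <+> B) :|: (T <+> B).
  apply/setP => z; rewrite inE; apply/sumsetP/orP.
    move=> [x [y [/setU1P[->|xT] yB ->]]]; [left|right]; rewrite mem_sumset //.
    by rewrite inE.
  by case=> /sumsetP[x [y [xT yB ->]]]; exists x, y; split; rewrite // !inE;
    [move: xT; rewrite inE => -> | rewrite xT orbT].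
rewrite cardsU dis cards0 subn0 TB cardsU1 aT mulnDl mul1n eqn_add2r.
by rewrite /sumset imset2_set1l card_imset //; apply: addrI.
Qed.

(* Petridis: a minimiser [X] of [#|X <+> B| / #|X|]. *)
Lemma petridis A B : A != set0 ->
  exists X : {set F}, [/\ X \subset A, X != set0, (#|X <+> B| * #|A| <= #|A <+> B| * #|X|)%N
    & forall C, (#|X <+> B <+> C| * #|X| <= #|X <+> B| * #|X <+> C|)%N].
Proof.
move=> A0; pose P (X : {set F}) := (X \subset A) && (X != set0).
have PA : P A by rewrite /P subxx.
case: (Order.TotalTheory.arg_minP (fun X : {set F} => #|X <+> B|%:R / #|X|%:R : rat) PA).
move=> X /andP[XA X0] minX.
have {}minX (Z : {set F}) : Z \subset A -> (#|X <+> B| * #|Z| <= #|Z <+> B| * #|X|)%N.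
  move=> ZA; have [->|Z0] := eqVneq Z set0; first by rewrite cards0 muln0.
  have /minX : P Z by rewrite /P ZA.
  rewrite ler_pdivrMr ?ltr0n ?card_gt0 // mulrAC ler_pdivlMr ?ltr0n ?card_gt0 //.
  by rewrite -!natrM ler_nat.
exists X; split=> // [|C]; first exact: minX.
have [m] := ubnP #|C|; elim: m C => // m IH C; rewrite ltnS => leCm.
have [->|[c cC]] := set_0Vmem C.
  suff -> : X <+> B <+> set0 = set0 by rewrite cards0.
  by apply/setP => z; rewrite inE; apply/negbTE/sumsetP => -[x [y []]]; rewrite inE.
pose C' := C :\ c.
have /IH {}IH : (#|C'| < m)%N by move: leCm; rewrite (cardsD1 c) cC.
(* Adding [c] back to [C'] enlarges [X <+> C'] by at least [#|X| - #|X'|]. It enlarges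
   [X <+> B <+> C'] by at most [#|X <+> B| - #|X' <+> B|], since [X' <+> B <+> [set c]] is there
   already. Minimality of the ratio, tested on [X'], compares the two gains. *)
pose X' := [set x in X | x + c \in X <+> C'].
have X'X : X' \subset X by apply/subsetP => x; rewrite inE => /andP[].
have CE z : z \in C -> z = c \/ z \in C'.
  by rewrite -(setD1K cC) => /setU1P.
have h1 : (#|X <+> B <+> C| + #|X' <+> B| <= #|X <+> B <+> C'| + #|X <+> B|)%N.
  have sub : X <+> B <+> C \subset
      (X <+> B <+> C') :|: [set z + c | z in (X <+> B) :\: (X' <+> B)].
    apply/subsetP => _ /sumsetP[_ [z [/sumsetP[x [b [xX bB ->]]] /CE zC ->]]].
    rewrite inE; case: zC => [->|zC']; last by rewrite !mem_sumset.
    have [h|h] := boolP (x + b \in X' <+> B); last first.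
      by apply/orP; right; apply: (imset_f (fun z => z + c)); rewrite inE h mem_sumset.
    apply/orP; left; move/sumsetP: h => [x' [b' [+ b'B ->]]].
    rewrite inE addrAC => /andP[_ /sumsetP[x2 [c' [x2X c'C ->]]]].
    by rewrite addrAC !mem_sumset.
  have := subset_leq_card sub; have [le1 _] := leq_card_setU (X <+> B <+> C') [set z + c | z in (X <+> B) :\: (X' <+> B)].
  move/leq_trans => /(_ _ le1); rewrite card_imset; last exact: addIr.
  have := subset_leq_card (sumsetS X'X (subxx B)).
  rewrite cardsD (setIidPr (sumsetS X'X (subxx B))) => le2 le3.
  by apply: leq_trans (leq_add le3 (leqnn _)) _; rewrite -addnA subnK.
have h2 : (#|X <+> C'| + #|X| <= #|X <+> C| + #|X'|)%N.
  have sub : (X <+> C') :|: [set x + c | x in X :\: X'] \subset X <+> C.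
    apply/subsetP => z; rewrite inE => /orP[].
      by apply/subsetP/sumsetS => //; apply: subsetDl.
    by move=> /imsetP[x /setDP[xX _] ->]; rewrite mem_sumset.
  have := subset_leq_card sub; rewrite cardsU.
  have -> : (X <+> C') :&: [set x + c | x in X :\: X'] = set0.
    apply/setP => z; rewrite !inE; apply/negbTE/negP => /andP[h /imsetP[x]].
    by rewrite !inE => /andP[+ xX] hz; rewrite xX -hz h.
  rewrite cards0 subn0 card_imset; last exact: addIr.
  rewrite cardsD (setIidPr X'X) => le1.
  rewrite -(subnK (subset_leq_card X'X)) addnA.
  by apply: leq_add le1 (leqnn _).
have := minX X' (subset_trans X'X XA).
nia.
Qed.

Fixpoint nsum A (j : nat) : {set F} :=
  if j is j'.+1 then A <+> nsum A j' else [set 0].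

Definition ndiff A j := nsum A j <+> dilate (-1) (nsum A j).

(** Here [A <+> B] has at most [K ^ 2 * #|A|] elements. For the minimiser [X] of [petridis], each
    further summand [B] then costs a factor [K ^ 2], and the triangle inequality through [X] passes
    from sums to differences. *)
Lemma plunnecke A B n K j : (0 < n)%N -> (n <= K * #|A|)%N -> (#|A| <= n)%N ->
  (#|A <+> B| <= K * n)%N -> (#|ndiff B j| <= (K ^ 2) ^ (2 * j) * n)%N.
Proof.
move=> n0 nA An AB.
have A0 : A != set0 by rewrite -card_gt0; move: n0 nA; case: #|A| => //; lia.
have [X [XA X0 h1 h2]] := petridis B A0.
have {}h1 : (#|X <+> B| <= K ^ 2 * #|X|)%N.
  have : (#|A <+> B| <= K ^ 2 * #|A|)%N.
    by apply: leq_trans AB _; rewrite -mulnn -mulnA leq_mul2l nA orbT.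
  have A1 : (0 < #|A|)%N by rewrite card_gt0.
  move=> h; rewrite -(leq_pmul2r A1); apply: leq_trans h1 _.
  by rewrite mulnAC leq_mul2r h orbT.
have X1 : (0 < #|X|)%N by rewrite card_gt0.
have hj i : (#|X <+> nsum B i| <= (K ^ 2) ^ i * #|X|)%N.
  elim: i => [|i IH] /=.
    suff -> : X <+> [set 0] = X by rewrite mul1n.
    apply/setP => z; apply/sumsetP/idP => [[x [y [xX /set1P-> ->]]]|zX].
      by rewrite addr0.
    by exists z, 0; rewrite inE addr0.
  rewrite sumsetA -(leq_pmul2r X1); apply: leq_trans (h2 _) _.
  rewrite expnS; apply: (leq_trans (leq_mul h1 IH)).
  by rewrite mulnACA mulnA.
rewrite -(leq_pmul2r X1); apply: leq_trans (ruzsa_triangle _ _ _) _.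
rewrite ![nsum B j <+> X]sumsetC; apply: leq_trans (leq_mul (hj j) (hj j)) _.
have XA' := subset_leq_card XA.
by rewrite mulnACA -expnD addnn -mul2n -!mulnA leq_mul2l leq_mul2r; lia.
Qed.

End Sumsets.

(** * The approximate ring of multipliers *)

Section Covering.
Variable F : finFieldType.
Implicit Types (A B G M T X Y : {set F}) (a b x y c : F).

Lemma mem_nsumD A i j x y :
  x \in nsum A i -> y \in nsum A j -> x + y \in nsum A (i + j).
Proof.
elim: i x => [|i IH] x /=; first by move=> /set1P ->; rewrite add0r.
move=> /sumsetP[a [z [aA zA ->]]] yA; rewrite -addrA.
by rewrite mem_sumset ?IH.
Qed.

Lemma ndiffP A j z :
  reflect (exists x y, [/\ x \in nsum A j, y \in nsum A j & z = x - y]) (z \in ndiff A j).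
Proof.
apply: (iffP (sumsetP _ _ _)).
  by move=> [x [_ [xA /imsetP[y yA ->] ->]]]; exists x, y; rewrite mulN1r.
move=> [x [y [xA yA ->]]]; exists x, (- y); split=> //.
by rewrite -[- y]mulN1r mem_dilate.
Qed.

Lemma mem_ndiffD A i j x y :
  x \in ndiff A i -> y \in ndiff A j -> x + y \in ndiff A (i + j).
Proof.
move=> /ndiffP[x1 [x2 [hx1 hx2 ->]]] /ndiffP[y1 [y2 [hy1 hy2 ->]]].
apply/ndiffP; exists (x1 + y1), (x2 + y2); rewrite !mem_nsumD //; split=> //; ring.
Qed.

Lemma mem_ndiffN A i x : x \in ndiff A i -> - x \in ndiff A i.
Proof.
move=> /ndiffP[x1 [x2 [hx1 hx2 ->]]]; apply/ndiffP; exists x2, x1.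
by rewrite opprB.
Qed.

Lemma mem_ndiff1 A x y : x \in A -> y \in A -> x - y \in ndiff A 1.
Proof.
have h z : z \in A -> z \in nsum A 1.
  by move=> zA; rewrite -[z]addr0; apply: mem_sumset; rewrite ?inE.
by move=> xA yA; apply/ndiffP; exists x, y; rewrite !h.
Qed.

Lemma ndiff_mono A i j : A != set0 -> (i <= j)%N -> ndiff A i \subset ndiff A j.
Proof.
move=> /set0Pn[a aA] /subnK <-; elim: (j - i)%N => [//|k IH].
apply: subset_trans IH _; rewrite addSn; apply/subsetP => x hx.
by rewrite -[x]add0r -add1n mem_ndiffD // -(subrr a) mem_ndiff1.
Qed.

Lemma card_nsum Y j : (#|nsum Y j| <= #|Y| ^ j)%N.
Proof.
elim: j => [|j IH] /=; first by rewrite cards1.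
by rewrite expnS; apply: leq_trans (card_sumset_le _ _) (leq_mul (leqnn _) IH).
Qed.

(* [x] maps [A] into few translates of [ndiff A i]; such [x] form an
   approximate subring. *)
Definition covered A (m i : nat) (x : F) : Prop :=
  exists Y, (#|Y| <= m)%N /\ forall a, a \in A -> x * a \in Y <+> ndiff A i.

Lemma covered_mono A m m' i i' x : A != set0 -> (m <= m')%N -> (i <= i')%N ->
  covered A m i x -> covered A m' i' x.
Proof.
move=> A0 mm' ii' [Y [Ym h]]; exists Y; split; first exact: leq_trans Ym mm'.
by move=> a /h; apply/subsetP/sumsetS => //; apply: ndiff_mono.
Qed.

Lemma coveredD A m m' i i' x y :
  covered A m i x -> covered A m' i' y -> covered A (m * m') (i + i') (x + y).
Proof.
move=> [Y [Ym h]] [Y' [Ym' h']]; exists (Y <+> Y'); split.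
  exact: leq_trans (card_sumset_le _ _) (leq_mul Ym Ym').
move=> a aA; have /sumsetP[s [t [sY tA e]]] := h a aA.
have /sumsetP[s' [t' [sY' tA' e']]] := h' a aA.
by rewrite mulrDl e e' addrACA mem_sumset ?mem_ndiffD // mem_sumset.
Qed.

Lemma coveredN A m i x : covered A m i x -> covered A m i (- x).
Proof.
move=> [Y [Ym h]]; exists (dilate (-1) Y); split.
  exact: leq_trans (card_dilate_le _ _) Ym.
move=> a aA; have /sumsetP[s [t [sY tA e]]] := h a aA.
by rewrite mulNr e opprD -[- s]mulN1r mem_sumset ?mem_ndiffN ?mem_dilate.
Qed.

(** Write [y * a = s + (t1 - t2)] with [s] in [Y'] and [t1], [t2] sums of [i'] elements of [A].
    Multiplication by [x] moves each of these [2 * i'] summands into a translate of [ndiff A i] by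
    an element of [Y], whence the exponent of [m]. *)
Lemma coveredM A m m' i i' x y :
  covered A m i x -> covered A m' i' y ->
  covered A (m' * m ^ (2 * i')) (2 * (i * i')) (x * y).
Proof.
move=> [Y [Ym h]] [Y' [Ym' h']].
have hs j s : s \in nsum A j -> x * s \in nsum Y j <+> ndiff A (i * j).
  elim: j s => [|j IH] s /=.
    move=> /set1P ->; rewrite mulr0 muln0 -[X in X \in _]addr0 mem_sumset ?inE //.
    by apply/ndiffP; exists 0, 0; rewrite !inE subr0.
  move=> /sumsetP[a [s' [aA s'A ->]]]; rewrite mulrDr.
  have /sumsetP[u [v [uY vA ->]]] := h a aA.
  have /sumsetP[u' [v' [uY' vA' ->]]] := IH s' s'A.
  by rewrite addrACA mulnS mem_sumset ?mem_ndiffD // mem_sumset.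
exists (dilate x Y' <+> ndiff Y i'); split.
  apply: leq_trans (card_sumset_le _ _) (leq_mul _ _).
    exact: leq_trans (card_dilate_le _ _) Ym'.
  have hY : (#|nsum Y i'| <= m ^ i')%N.
    by apply: leq_trans (card_nsum _ _) _; case: (i') => // k; rewrite leq_exp2r.
  apply: leq_trans (card_sumset_le _ _) _; rewrite mul2n -addnn expnD.
  exact: leq_mul hY (leq_trans (card_dilate_le _ _) hY).
move=> a aA; have /sumsetP[s [t [sY' /ndiffP[t1 [t2 [ht1 ht2 et]]] e]]] := h' a aA.
have /sumsetP[u1 [v1 [uY1 vA1 e1]]] := hs _ _ ht1.
have /sumsetP[u2 [v2 [uY2 vA2 e2]]] := hs _ _ ht2.
have -> : x * y * a = x * s + (u1 - u2) + (v1 - v2).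
  by rewrite -mulrA e et mulrDr mulrBr e1 e2; ring.
rewrite mul2n -addnn mem_sumset ?mem_ndiffD ?mem_ndiffN // mem_sumset ?mem_dilate //.
by apply/ndiffP; exists u1, u2.
Qed.

(** Dilating by [y] preserves the cardinality and turns the set into [y A + x A], where both
    coverings apply. This is how quotients are treated without covering them. *)
Lemma card_sumset_dilate A m m' i i' x y : covered A m i x -> covered A m' i' y ->
  y != 0 -> (#|A <+> dilate (x / y) A| <= m * m' * #|ndiff A (i + i')|)%N.
Proof.
move=> [Y [Ym h]] [Y' [Ym' h']] y0.
rewrite -(card_dilate (A <+> _) y0).
have sub : dilate y (A <+> dilate (x / y) A) \subset (Y <+> Y') <+> ndiff A (i + i').
  apply/subsetP => _ /imsetP[_ /sumsetP[a [_ [aA /imsetP[b bA ->] ->]]] ->].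
  have -> : y * (a + x / y * b) = x * b + y * a by field.
  have /sumsetP[s [t [sY tA ->]]] := h b bA.
  have /sumsetP[s' [t' [sY' tA' ->]]] := h' a aA.
  by rewrite addrACA mem_sumset ?mem_ndiffD // mem_sumset.
apply: leq_trans (subset_leq_card sub) _.
apply: leq_trans (card_sumset_le _ _) _; rewrite leq_mul2r.
by rewrite (leq_trans (card_sumset_le _ _) (leq_mul Ym Ym')) orbT.
Qed.

(* Double counting the solutions of [a + x b = a' + x b'] with [x] in [G]:
   off the diagonal a solution determines [x]. *)
Lemma card_small_dilates A G (Q : nat) :
  (forall x, x \in G -> (#|A <+> dilate x A| <= Q)%N) ->
  (0 < #|A|)%N -> (2 * Q <= #|A| ^ 2)%N -> (#|G| <= 2 * Q)%N.
Proof.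
move=> small A0 QA; pose D := setX A A.
have cD : #|D| = (#|A| ^ 2)%N by rewrite cardsX mulnn.
pose E x := [set w in setX D D | w.1.1 + x * w.1.2 == w.2.1 + x * w.2.2].
have lowE x : x \in G -> (#|A| ^ 4 <= Q * #|E x|)%N.
  move=> xG; have := @card_fibre_pairs _ _ D (fun u => u.1 + x * u.2) (A <+> dilate x A) _.
  rewrite cD -expnM => h; apply: leq_trans (h _) _.
    by move=> [a b]; rewrite inE => /andP[aA bA]; rewrite mem_sumset ?mem_dilate.
  by rewrite leq_mul2r small ?orbT.
have upE : (\sum_(x in G) #|E x| <= #|A| ^ 2 * #|G| + #|A| ^ 4)%N.
  under eq_bigr => x _ do rewrite /E card_sum_bool.
  rewrite exchange_big /=.
  apply: (@leq_trans (\sum_(w in setX D D) ((w.1 == w.2) * #|G| + 1))%N); last first.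
    rewrite big_split /= -big_distrl /= sum_nat_const muln1 cardsX cD.
    rewrite -card_sum_bool mulnn -expnM leq_add2r leq_mul2r; apply/orP; right.
    have <- : #|[set (u, u) | u in D]| = (#|A| ^ 2)%N.
      by rewrite card_imset ?cD // => u v [].
    apply: subset_leq_card; apply/subsetP => -[u v]; rewrite !inE /=.
    by move=> /andP[/andP[uD _] /eqP <-]; apply/imsetP; exists u; rewrite // !inE.
  apply: leq_sum => -[u v] _; rewrite -card_sum_bool /=.
  have [<-|uv] := eqVneq u v.
    by rewrite mul1n; apply: leq_trans (leq_addr _ _); apply: subset_leq_card;
      apply/subsetP => x; rewrite inE => /andP[].
  rewrite mul0n add0n; apply/card_le1_eqP => x y.
  rewrite !inE => /andP[_ /eqP e] /andP[_ /eqP e'].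
  have h : (x - y) * (u.2 - v.2) = 0.
    have -> : (x - y) * (u.2 - v.2) = (u.1 + x * u.2 - (v.1 + x * v.2))
       - (u.1 + y * u.2 - (v.1 + y * v.2)) by ring.
    by rewrite e e' !subrr.
  move/eqP: h; rewrite mulf_eq0 !subr_eq0 => /orP[/eqP -> //|/eqP e2].
  by case/eqP: uv; rewrite e2 in e; move/addIr: e => e1; case: u v e1 e2 {e'} => [? ?] [? ?] /= -> ->.
have A4 : (0 < #|A| ^ 4)%N by rewrite expn_gt0 A0.
have h1 : (#|G| * #|A| ^ 4 <= Q * (#|A| ^ 2 * #|G| + #|A| ^ 4))%N.
  apply: leq_trans (leq_mul (leqnn Q) upE).
  by rewrite big_distrr /= -sum_nat_const; apply: leq_sum.
have h2 : (2 * Q * (#|A| ^ 2 * #|G|) <= #|A| ^ 4 * #|G|)%N.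
  by rewrite mulnA (_ : 4 = 2 + 2)%N // expnD !leq_mul2r QA !orbT.
rewrite -(leq_pmul2r A4).
move: h1 h2; move: (#|A| ^ 4)%N (#|A| ^ 2)%N #|G| => u v w; lia.
Qed.

(* Either every element of [F] is a quotient of differences of elements of
   [M], or some such quotient [r] has [r + 1] not of this form, and then
   [(u, v) |-> u + (r + 1) v] is injective on [M x M]. *)
Lemma covered_growth A M (m : nat) :
  (forall x : F, exists k : nat, x = k%:R) ->
  A != set0 -> (0 < m)%N -> (1 < #|M|)%N ->
  (forall x, x \in M -> covered A m 2 x) ->
  let Q := (m ^ 28 * #|ndiff A 52|)%N in
  (2 * Q <= #|A| ^ 2)%N -> (#|F| <= 2 * Q)%N \/ (#|M| ^ 2 <= 2 * Q)%N.
Proof.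
move=> gen A0 m0 M2 cov Q QA.
have A1 : (0 < #|A|)%N by rewrite card_gt0.
have [x0 [x1 [x0M x1M x01]]] := card_gt1P M2.
have covB x y : x \in M -> y \in M -> covered A (m ^ 2) 4 (x - y).
  by move=> xM yM; rewrite -mulnn (_ : 4 = 2 + 2)%N //; apply: coveredD; [|apply: coveredN]; exact: cov.
(* The bounds fit the numerator [(c - d) * u + (a - b + (c - d)) * v] met below: its terms cost
   [(m ^ 9, 16)] and [(m ^ 17, 32)]. *)
have small x y : covered A (m ^ 26) 48 x -> covered A (m ^ 2) 4 y -> y != 0 ->
    (#|A <+> dilate (x / y) A| <= Q)%N.
  move=> cx cy y0; apply: leq_trans (card_sumset_dilate cx cy y0) _.
  by rewrite -expnD.
pose R := [set r | [exists u in setX (setX M M) (setX M M),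
   (u.2.1 != u.2.2) && (r * (u.2.1 - u.2.2) == u.1.1 - u.1.2)]].
have RP r : reflect (exists a b c d, [/\ a \in M, b \in M, c \in M, d \in M &
    c != d /\ r * (c - d) = a - b]) (r \in R).
  rewrite inE; apply: (iffP exists_inP) => [[[[a b] [c d]]]|].
    rewrite !inE /= => /andP[/andP[? ?] /andP[? ?]] /andP[? /eqP ?].
    by exists a, b, c, d.
  move=> [a [b [c [d [aM bM cM dM [cd e]]]]]]; exists ((a, b), (c, d)); rewrite ?inE /=.
    by rewrite aM bM cM dM.
  by rewrite cd e eqxx.
(* [R] contains 0, so if it is stable under adding 1 it is all of [F] by [gen]. *)
have [/forall_inP closed|] := boolP [forall r in R, r + 1 \in R].
  left; rewrite -cardsT; apply: (@card_small_dilates A) => // x _.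
  have : x \in R.
    have [k ->] := gen x; elim: k => [|k IH]; last by rewrite -addn1 natrD closed.
    by apply/RP; exists x0, x0, x0, x1; rewrite mul0r subrr.
  move=> /RP[a [b [c [d [aM bM cM dM [cd e]]]]]].
  have cd0 : c - d != 0 by rewrite subr_eq0.
  rewrite -[x](mulfK cd0) e; apply: small; [|exact: covB|by []].
  by apply: covered_mono (covB _ _ aM bM) => //; rewrite leq_pexp2l.
rewrite negb_forall_in => /exists_inP[r /RP[a [b [c [d [aM bM cM dM [cd e]]]]]] r1].
right; have cd0 : c - d != 0 by rewrite subr_eq0.
pose f u : F := u.1 + (r + 1) * u.2.
have injf : {in setX M M &, injective f}.
  move=> [u v] [u' v']; rewrite !inE /f /= => /andP[uM vM] /andP[uM' vM'] euv.
  have [vv|vv] := eqVneq v v'; first by move: euv; rewrite vv => /addIr ->.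
  case/negP: r1; apply/RP; exists u', u, v, v'; split=> //; split=> //.
  by rewrite mulrBr -[u'](addrK ((r + 1) * v')) -euv; ring.
rewrite -mulnn -cardsX -(card_in_imset injf); apply: (@card_small_dilates A) => //.
move=> _ /imsetP[[u v] + ->]; rewrite inE /= => /andP[uM vM].
have -> : f (u, v) = ((c - d) * u + (a - b + (c - d)) * v) / (c - d).
  by rewrite /f /= -e; field.
apply: small; [|exact: covB|by []].
have covP : covered A (m ^ 9) 16 ((c - d) * u).
  have := coveredM (covB _ _ cM dM) (cov _ uM).
  by rewrite -expnM -expnS.
have covP' : covered A (m ^ 17) 32 ((a - b + (c - d)) * v).
  have := coveredM (coveredD (covB _ _ aM bM) (covB _ _ cM dM)) (cov _ vM).
  by rewrite -expnD -expnM -expnS.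
by have := coveredD covP covP'; rewrite -expnD.
Qed.

End Covering.

(** * Growth of sets rich in affine combinations *)

Section AffineCombinations.
Variable F : finFieldType.
Implicit Types (A B X Y W M Lam : {set F}) (a b x y l mu nu : F).

(** A path from [a] to [b] yields three elements of [W], the values [al * u + be * v] on its edges.
    Their alternating sum is [al * a + be * b], so the triple determines the element
    [s = a + be / al * b] of the sumset. Each [s] owns at least [n ^ 2 / (4096 * K ^ 5)] of the at
    most [n ^ 3] triples. *)
Lemma bsg_sumset W (al be : F) (n K : nat) : al != 0 -> be != 0 ->
  (0 < n)%N -> (0 < K)%N -> (#|W| <= n)%N ->
  (n ^ 2 <= K * \sum_(u in W) #|[set v in W | (al * u + be * v)%R \in W]|)%N ->
  exists A B : {set F}, [/\ A \subset W, B \subset W, (n <= 8 * K * #|A|)%N,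
    (n <= 4 * K * #|B|)%N &
    (#|A <+> dilate (be / al) B| <= 4096 * K ^ 5 * n)%N].
Proof.
move=> al0 be0 n0 K0 Wn edges.
have [A [B [AW BW nA nB hp]]] :=
  @balog_szemeredi_gowers _ _ W W (fun u v => al * u + be * v \in W) n K n0 K0 Wn Wn edges.
exists A, B; split=> //.
pose S := A <+> dilate (be / al) B.
pose rep s := odflt (0, 0) [pick u in setX A B | u.1 + be / al * u.2 == s].
have repP s : s \in S ->
    [/\ (rep s).1 \in A, (rep s).2 \in B & (rep s).1 + be / al * (rep s).2 = s].
  move=> /sumsetP[u [_ [uA /imsetP[v vB ->] ->]]]; rewrite /rep.
  case: pickP => /= [[a b]|/(_ (u, v))]; rewrite !inE.
    by move=> /andP[/andP[? ?] /eqP].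
  by rewrite uA vB eqxx.
pose e u v := al * u + be * v \in W.
pose f s (u : F * F) :=
  (al * (rep s).1 + be * u.2, al * u.1 + be * u.2, al * u.1 + be * (rep s).2).
pose P s := f s @: paths3 W W e (rep s).1 (rep s).2.
have cP s : #|P s| = #|paths3 W W e (rep s).1 (rep s).2|.
  apply: card_imset => -[u v] [u' v'] [/addrI/(mulfI be0) -> /addIr/(mulfI al0) ->] //.
have : (\sum_(s in S) #|P s| <= #|setX (setX W W) W|)%N.
  apply: sum_card_disjoint.
    move=> s sS; apply/subsetP => _ /imsetP[u + ->].
    by rewrite !inE => /andP[_ /and3P[h1 h2 h3]]; apply/andP; split; [apply/andP|].
  move=> s s' t /repP[_ _ es] /repP[_ _ es'] /imsetP[u _ ->] /imsetP[u' _ [h1 h2 h3]].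
  apply: (mulfI al0); rewrite -es -es'.
  have h v w : al * (v + be / al * w) = al * v + be * w by field.
  rewrite !h.
  have -> : al * (rep s).1 + be * (rep s).2 = (al * (rep s).1 + be * u.2)
     - (al * u.1 + be * u.2) + (al * u.1 + be * (rep s).2) by ring.
  by rewrite h1 h2 h3; ring.
rewrite !cardsX => h1.
have h2 : (n ^ 2 * #|S| <= 4096 * K ^ 5 * \sum_(s in S) #|P s|)%N.
  rewrite big_distrr /= mulnC -sum_nat_const; apply: leq_sum => s /repP[sA sB _].
  by rewrite cP; apply: hp.
have n2 : (0 < n ^ 2)%N by rewrite expn_gt0 n0.
have h3 : (#|W| * #|W| * #|W| <= n ^ 2 * n)%N.
  by rewrite leq_mul // -mulnn leq_mul.
rewrite -(leq_pmul2l n2); apply: leq_trans h2 _.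
by rewrite mulnCA leq_mul2l (leq_trans h1 h3) orbT.
Qed.

(** Ruzsa covering puts [A] in few translates of [mu0 * (Y - Y)], and [mu * Y] in few translates of
    [X - X]. Multiplying the first by [mu / mu0] and inserting the second leaves translates of
    [2 X - 2 X], which lies in [ndiff A 2]. The three factors [L ^ 2] come from one covering of [A]
    and two uses of that of [mu * Y]. *)
Lemma covered_ratio A B X Y mu0 mu (n L : nat) :
  (0 < n)%N -> (0 < L)%N -> mu0 != 0 -> mu != 0 -> X \subset A -> Y \subset B ->
  (#|A <+> dilate mu0 B| <= L * n)%N -> (#|X <+> dilate mu Y| <= L * n)%N ->
  (n <= L * #|X|)%N -> (n <= L * #|Y|)%N ->
  covered A (L ^ 6) 2 (mu / mu0).
Proof.
move=> n0 L0 mu00 mu_n0 XA YB hA hX nX nY.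
have ne (Z : {set F}) : (n <= L * #|Z|)%N -> Z != set0.
  by rewrite -card_gt0; case: #|_| => //; rewrite muln0; case: (n) n0.
have X0 := ne _ nX; have Y0 := ne _ nY.
have dY0 nu : nu != 0 -> dilate nu Y != set0.
  by move=> nu0; rewrite -card_gt0 card_dilate // card_gt0.
have [T [_ cT TP]] := @ruzsa_covering _ (dilate mu Y) X X0.
have [T' [_ cT' TP']] := @ruzsa_covering _ A (dilate mu0 Y) (dY0 _ mu00).
have {}cT : (#|T| <= L ^ 2)%N.
  have X1 : (0 < #|X|)%N by rewrite card_gt0.
  rewrite -(leq_pmul2r X1); apply: leq_trans cT _; rewrite sumsetC.
  by apply: leq_trans hX _; rewrite -mulnn -mulnA leq_mul2l nX orbT.
have {}cT' : (#|T'| <= L ^ 2)%N.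
  have Y1 : (0 < #|dilate mu0 Y|)%N by rewrite card_dilate // card_gt0.
  rewrite -(leq_pmul2r Y1); apply: leq_trans cT' _.
  apply: (leq_trans (subset_leq_card (sumsetS (subxx A) (imsetS _ YB)))).
  by apply: leq_trans hA _; rewrite card_dilate // -mulnn -mulnA leq_mul2l nY orbT.
have decT y : y \in Y -> exists t x x', [/\ t \in T, x \in X, x' \in X & mu * y = t + (x - x')].
  move=> /(mem_dilate mu)/(subsetP TP)/sumsetP[t [_ [tT /sumsetP[x [_ [xX /imsetP[x' xX' ->] ->]]] ->]]].
  by exists t, x, x'; rewrite mulN1r.
exists (dilate (mu / mu0) T' <+> (T <+> dilate (-1) T)); split.
  rewrite (_ : 6 = 2 + (2 + 2))%N // !expnD.
  apply: leq_trans (card_sumset_le _ _) (leq_mul (leq_trans (card_dilate_le _ _) cT') _).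
  exact: leq_trans (card_sumset_le _ _) (leq_mul cT (leq_trans (card_dilate_le _ _) cT)).
move=> a /(subsetP TP')/sumsetP[t' [_ [t'T' /sumsetP[_ [_ [/imsetP[y yY ->]
  /imsetP[_ /imsetP[y' yY' ->] ->] ->]]] ->]]].
have [t1 [x1 [x1' [tT1 xX1 xX1' e1]]]] := decT _ yY.
have [t2 [x2 [x2' [tT2 xX2 xX2' e2]]]] := decT _ yY'.
have -> : mu / mu0 * (t' + (mu0 * y + -1 * (mu0 * y'))) =
    (mu / mu0 * t' + (t1 + -1 * t2)) + ((x1 - x1') - (x2 - x2')).
  have -> : mu / mu0 * (t' + (mu0 * y + -1 * (mu0 * y'))) = mu / mu0 * t' + mu * y - mu * y' by field.
  by rewrite e1 e2; ring.
rewrite mem_sumset //.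
  by apply: mem_sumset; [exact: mem_dilate | apply: mem_sumset => //; exact: mem_dilate].
apply: (@mem_ndiffD _ _ 1 1); rewrite ?mem_ndiffN // mem_ndiff1 //; exact: (subsetP XA).
Qed.

End AffineCombinations.

(** Each popular [l] gives, by [bsg_sumset], sets [A_l], [B_l] with [A_l + l / (1 - l) * B_l] small.
    Many of the products [A_l x B_l] meet one fixed [A_l0 x B_l0] in a large set. The corresponding
    ratios of multipliers are then all covered with respect to [A_l0], and [covered_growth] applies
    to them. *)
Lemma affine_combinations_growth : exists C : nat,
  forall (F : finFieldType) (W Lam : {set F}) (n K : nat),
  (forall x : F, exists k : nat, x = k%:R) ->
  (0 < n)%N -> (1 < K)%N -> (#|W| <= n)%N -> (#|Lam| <= n)%N ->
  0 \notin Lam -> 1 \notin Lam ->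
  (n ^ 3 <= K * \sum_(l in Lam) \sum_(u in W)
     #|[set v in W | ((1 - l) * u + l * v)%R \in W]|)%N ->
  (n <= K ^ C)%N \/ (#|F| <= K ^ C * n)%N.
Proof.
(* As [K >= 2], every constant [2 ^ a * K ^ b] met below, the largest being [2 ^ 17 * K ^ 5], is at
   most [L = K ^ 22]. The final bound is [L ^ 377 * n], and comparing it with squares of sets of
   size [n / L] requires [n] to exceed [L ^ 379]. *)
exists (22 * 380)%N => F W Lam n K gen n0 K1 Wn Lamn Lam0 Lam1 big.
rewrite !expnM; set L := (K ^ 22)%N.
have K0 : (0 < K)%N by apply: ltnW.
have L1 : (1 < L)%N by rewrite (ltn_exp2l 0).
have L0 : (0 < L)%N by apply: ltnW.
have powK (a b : nat) : (a + b <= 22)%N -> (2 ^ a * K ^ b <= L)%N.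
  move=> ab; apply: leq_trans (leq_pexp2l K0 ab); rewrite expnD leq_mul2r.
  by case: (a) => [|a']; rewrite ?orbT // leq_exp2r ?K1 ?orbT.
clearbody L.
pose T (l : F) := (\sum_(u in W) #|[set v in W | ((1 - l) * u + l * v)%R \in W]|)%N.
have Tn l : (T l <= n ^ 2)%N.
  apply: (@leq_trans (\sum_(u in W) n)%N).
    apply: leq_sum => u _; apply: leq_trans Wn; apply: subset_leq_card.
    by apply/subsetP => v; rewrite inE => /andP[].
  by rewrite sum_nat_const -mulnn leq_mul2r Wn orbT.
pose P := [set l in Lam | (n ^ 2 <= 2 * K * T l)%N].
have nP : (n <= 2 * K * #|P|)%N.
  have pop := sum_popular Lam T (2 * K) (n ^ 2); rewrite -/P in pop.
  have h1 : (#|Lam| * n ^ 2 <= n ^ 3)%N by rewrite expnS leq_mul2r Lamn orbT.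
  have h2 : (\sum_(l in P) T l <= #|P| * n ^ 2)%N.
    by rewrite -sum_nat_const; apply: leq_sum.
  have h3 : (K * \sum_(l in P) T l <= K * (#|P| * n ^ 2))%N by rewrite leq_mul2l h2 orbT.
  have n2 : (0 < n ^ 2)%N by rewrite expn_gt0 n0.
  have {}big : (n ^ 3 <= K * \sum_(l in Lam) T l)%N := big.
  rewrite -(leq_pmul2r n2) -expnS -!mulnA; rewrite -!mulnA in pop.
  move: big h1 h3 pop.
  by move: (K * _)%N (K * _)%N (K * _)%N (#|Lam| * _)%N (n ^ 3)%N; lia.
pose ok (l : F) (AB : {set F} * {set F}) := [&& AB.1 \subset W, AB.2 \subset W,
  (n <= 16 * K * #|AB.1|)%N, (n <= 8 * K * #|AB.2|)%N &
  (#|AB.1 <+> dilate (l / (1 - l)) AB.2| <= 2 ^ 17 * K ^ 5 * n)%N].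
have [AB ABP] : exists AB, forall l, l \in P -> ok l (AB l).
  exists (fun l => odflt (set0, set0) [pick AB | ok l AB]) => l.
  rewrite inE => /andP[lLam Tl].
  have l0 : l != 0 by apply: contraNneq Lam0 => <-.
  have l1 : 1 - l != 0 by rewrite subr_eq0; apply: contraNneq Lam1 => ->.
  have K2 : (0 < 2 * K)%N by rewrite muln_gt0.
  have [A [B [AW BW nA nB AB]]] := bsg_sumset l1 l0 n0 K2 Wn Tl.
  case: pickP => [//|/(_ (A, B))]; rewrite /ok /= AW BW.
  rewrite (_ : 16 * K = 8 * (2 * K))%N ?nA; last by rewrite mulnA.
  rewrite (_ : 8 * K = 4 * (2 * K))%N ?nB; last by rewrite mulnA.
  rewrite (_ : 2 ^ 17 * K ^ 5 = 4096 * (2 * K) ^ 5)%N ?AB //.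
  by rewrite expnMn mulnA.
pose D l := setX (AB l).1 (AB l).2.
have P0 : P != set0 by rewrite -card_gt0; move: n0 nP; case: #|P| => //; rewrite muln0; case: (n).
have [l0 l0P hl0] : exists2 l0, l0 \in P & (#|P| <= 2 * (2 ^ 7 * K ^ 2) ^ 2 *
    #|[set l in P | n ^ 2 <= 2 * (2 ^ 7 * K ^ 2) ^ 2 * #|D l :&: D l0| ]|)%N.
  apply: (@dense_family_intersection _ _ P D (setX W W)) => //.
  - by rewrite expn_gt0 n0.
  - by rewrite cardsX -mulnn leq_mul.
  - by move=> l /ABP/and5P[AW BW _ _ _]; rewrite setXS.
  - move=> l /ABP/and5P[_ _ nA nB _]; rewrite cardsX -!mulnn.
    by apply: leq_trans (leq_mul nA nB) _; apply: eq_leq; lia.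
set M := [set l in P | _] in hl0.
have {hl0} nM : (n <= L * #|M|)%N.
  apply: leq_trans nP _; apply: leq_trans (leq_mul (leqnn _) hl0) _.
  rewrite mulnA leq_mul2r; apply/orP; right.
  by apply: leq_trans (powK 16 5 _)%N => //; apply: eq_leq; rewrite expnMn -!expnM !expnS; lia.
pose A0 := (AB l0).1; pose B0 := (AB l0).2; pose rat (l : F) := l / (1 - l).
have PLam l : l \in P -> l != 0 /\ 1 - l != 0.
  rewrite inE => /andP[lLam _]; split; first by apply: contraNneq Lam0 => <-.
  by rewrite subr_eq0; apply: contraNneq Lam1 => ->.
have rat0 l : l \in P -> rat l != 0.
  by move=> /PLam[h1 h2]; rewrite mulf_neq0 ?invr_neq0.
pose M' := [set rat l / rat l0 | l in M].
have MP l : l \in M -> l \in P by rewrite inE => /andP[].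
have cM' : #|M'| = #|M|.
  apply: card_in_imset => x y /MP/PLam[_ x1] /MP/PLam[_ y1].
  move/(mulIf (invr_neq0 (rat0 _ l0P))); rewrite /rat => /eqP.
  by rewrite eqr_div // !mulrBr !mulr1 [y * x]mulrC => /eqP/addIr.
have /and5P[A0W B0W nA0 nB0 hAB0] := ABP _ l0P.
have powKn (a b x : nat) : (a + b <= 22)%N -> (2 ^ a * K ^ b * x <= L * x)%N.
  by move=> ab; rewrite leq_mul2r powK ?orbT.
have nA0L : (n <= L * #|A0|)%N.
  by apply: leq_trans nA0 (powKn 4 1 _ _)%N.
have nB0L : (n <= L * #|B0|)%N.
  by apply: leq_trans nB0 (powKn 3 1 _ _)%N.
have hAB0L : (#|A0 <+> dilate (rat l0) B0| <= L * n)%N.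
  by apply: leq_trans hAB0 (powKn 17 5 _ _)%N.
have covM x : x \in M' -> covered A0 (L ^ 6) 2 x.
  move=> /imsetP[l lM ->]; have lP := MP _ lM.
  have /and5P[AW BW _ _ hAB] := ABP _ lP.
  have big2 : (n ^ 2 <= L * (#|(AB l).1 :&: A0| * #|(AB l).2 :&: B0|))%N.
    move: lM; rewrite inE => /andP[_]; rewrite /D.
    have -> : setX (AB l).1 (AB l).2 :&: setX (AB l0).1 (AB l0).2 =
        setX ((AB l).1 :&: A0) ((AB l).2 :&: B0).
      by apply/setP => -[u v]; rewrite !inE /=; case: (u \in _); rewrite //= ?andbF // andbCA.
    rewrite cardsX => h; apply: leq_trans h _.
    apply: leq_trans (powKn 15 4 _ _)%N => //; rewrite leq_mul2r; apply/orP; right.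
    by apply: eq_leq; rewrite expnMn -!expnM !expnS; lia.
  have c1 : (#|(AB l).1 :&: A0| <= n)%N.
    exact: leq_trans (subset_leq_card (subset_trans (subsetIl _ _) AW)) Wn.
  have c2 : (#|(AB l).2 :&: B0| <= n)%N.
    exact: leq_trans (subset_leq_card (subset_trans (subsetIl _ _) BW)) Wn.
  apply: (@covered_ratio _ A0 B0 ((AB l).1 :&: A0) ((AB l).2 :&: B0) _ _ n L) => //.
  - exact: rat0.
  - exact: rat0.
  - exact: subsetIr.
  - exact: subsetIr.
  - apply: leq_trans (powKn 17 5 n _)%N => //; apply: leq_trans hAB.
    by apply/subset_leq_card/sumsetS; [exact: subsetIl | apply/imsetS/subsetIl].
  - by rewrite -(leq_pmul2r n0) mulnn; apply: leq_trans big2 _; rewrite -mulnA !leq_mul2l c2 !orbT.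
  - by rewrite -(leq_pmul2r n0) mulnn; apply: leq_trans big2 _;
      rewrite -mulnA leq_mul2l [X in (_ <= X)%N]mulnC leq_mul2r c1 !orbT.
have A00 : A0 != set0.
  by rewrite -card_gt0; move: n0 nA0L; case: #|A0| => //; rewrite muln0; case: (n).
have [|nbig] := leqP n (L ^ 380); first by left.
right; have Ln : (L < n)%N by apply: leq_ltn_trans nbig; rewrite -[X in (X <= _)%N]expn1 leq_pexp2l.
have M'2 : (1 < #|M'|)%N.
  rewrite cM'; case: ltnP => // M1; move: (leq_trans nM (leq_mul (leqnn L) M1)).
  by rewrite muln1 leqNgt Ln.
have L60 : (0 < L ^ 6)%N by rewrite expn_gt0 L0.
have hnd : (#|ndiff A0 52| <= (L ^ 2) ^ (2 * 52) * n)%N.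
  apply: (@plunnecke _ (dilate (rat l0) B0)) => //.
  - by rewrite card_dilate ?rat0.
  - by rewrite card_dilate ?rat0 //; apply: leq_trans (subset_leq_card B0W) Wn.
  - by rewrite sumsetC.
(* The exponent is [1 + 6 * 28 + 2 * (2 * 52)], the 1 paying for the factor 2. *)
have Qle : (2 * ((L ^ 6) ^ 28 * #|ndiff A0 52|) <= L ^ 377 * n)%N.
  apply: leq_trans (leq_mul L1 (leq_mul (leqnn _) hnd)) _.
  rewrite -(expnM L 6 28) -(expnM L 2 (2 * 52)) mulnA -(expnS L (6 * 28)) mulnA.
  by rewrite -(expnD L (6 * 28).+1).
have sq (S : nat) : (n <= L * S)%N -> (n ^ 2 <= L ^ 2 * S ^ 2)%N.
  by move=> h; rewrite -expnMn leq_sqr.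
have Lpos (k : nat) : (0 < L ^ k)%N by rewrite expn_gt0 L0.
have up (x : nat) : (x <= L ^ 377 * n)%N -> (L ^ 2 * x < n ^ 2)%N.
  move=> h; apply: (@leq_ltn_trans (L ^ 379 * n)).
    by rewrite (expnD _ 2 377) -mulnA leq_mul2l h orbT.
  rewrite -mulnn ltn_mul2r n0 /=; apply: leq_ltn_trans nbig.
  by rewrite leq_pexp2l.
have QA : (2 * ((L ^ 6) ^ 28 * #|ndiff A0 52|) <= #|A0| ^ 2)%N.
  have := leq_trans (up _ Qle) (sq _ nA0L).
  by rewrite ltn_pmul2l // => /ltnW.
have [h|h] := covered_growth gen A00 L60 M'2 covM QA.
  apply: leq_trans h (leq_trans Qle _); rewrite leq_mul2r; apply/orP; right.
  by rewrite leq_pexp2l.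
by have := up _ (leq_trans h Qle); rewrite cM' ltnNge => /negP[]; exact: sq.
Qed.

(** * Three-step walks as Moebius maps *)

Section Walks.
Variables (F : finFieldType) (tau : F).
Hypotheses (tau0 : tau != 0) (tau1 : tau != 1).
Implicit Types (a b c x y : F) (t : F * F * F).

(** The relation [y = a (x + tau a) / (x + a)] with denominator cleared; the first conjunct excludes
    the pole. *)
Definition hom_edge x a y := (x + a != 0) && (y * (x + a) == a * (x + tau * a)).

(* The entries of [T_c (adj T_b) T_a], where [T_a] is the matrix
   [[a, tau a^2], [1, a]] of [x |-> a (x + tau a) / (x + a)]. *)
Definition w11 t := let: (a, b, c) := t in
  c * b * (a - tau * b) - tau * c ^+ 2 * (a - b).
Definition w12 t := let: (a, b, c) := t in
  c * tau * a * b * (a - b) + tau * c ^+ 2 * a * (b - tau * a).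
Definition w21 t := let: (a, b, c) := t in b * (a - tau * b) - c * (a - b).
Definition w22 t := let: (a, b, c) := t in tau * a * b * (a - b) + c * a * (b - tau * a).
Definition wnum t x := w11 t * x + w12 t.
Definition wden t x := w21 t * x + w22 t.
Definition walk t x := wnum t x / wden t x.
Definition vol t := let: (a, b, c) := t in a * b * c.
Definition wdet t := w11 t * w22 t - w12 t * w21 t.

(** If [a = b] or [b = c], two letters of the word cancel; if [w21 t = 0], the map fixes infinity.
    Outside these cases the map nearly determines its label. *)
Definition regular t := let: (a, b, c) := t in
  [&& a != 0, b != 0, c != 0, a != b, b != c & w21 t != 0].

(** Each of the three factors has determinant [1 - tau] times the square of its label. *)
Lemma wdetE t : wdet t = (1 - tau) ^+ 3 * vol t ^+ 2.
Proof. by case: t => -[a b] c; rewrite /wdet /w11 /w12 /w21 /w22 /vol; ring. Qed.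

Lemma regular_vol t : regular t -> vol t != 0.
Proof. by case: t => -[a b] c /and4P[a0 b0 c0 _] /=; rewrite !mulf_neq0. Qed.

Lemma regular_wdet t : regular t -> wdet t != 0.
Proof.
move=> /regular_vol v0; rewrite wdetE mulf_neq0 ?expf_neq0 //.
by rewrite subr_eq0 eq_sym.
Qed.

(** The walk goes from [x] to [y1] along [a], back to [x1] along [b], then to [y] along [c]. Its
    denominator factors as [(x + a) * (b - y1) * (x1 + c)], and [b != y1] because [tau != 1]. *)
Lemma hom_edge_walk a b c x x1 y1 y : b != 0 ->
  hom_edge x a y1 -> hom_edge x1 b y1 -> hom_edge x1 c y ->
  wden (a, b, c) x != 0 /\ walk (a, b, c) x = y.
Proof.
move=> b0 /andP[xa /eqP e1] /andP[xb /eqP e2] /andP[xc /eqP e3].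
have by1 : b - y1 != 0.
  apply: contra_neq tau1 => /subr0_eq h; move: e2; rewrite -h.
  by move/(mulfI b0)/addrI => h2; apply: (mulIf b0); rewrite mul1r -h2.
have e2' : b * x1 - y1 * x1 = y1 * b - tau * b ^+ 2.
  have -> : b * x1 - y1 * x1 = b * (x1 + tau * b) - tau * b ^+ 2 - y1 * (x1 + b) + y1 * b by ring.
  by rewrite e2; ring.
have hden : wden (a, b, c) x = (x + a) * (b - y1) * (x1 + c).
  have -> : (x + a) * (b - y1) * (x1 + c) = (x + a) * ((b * x1 - y1 * x1) + (b - y1) * c) by ring.
  rewrite e2'.
  have -> : (x + a) * (y1 * b - tau * b ^+ 2 + (b - y1) * c) =
     (b - c) * (y1 * (x + a)) + (x + a) * (b * c - tau * b ^+ 2) by ring.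
  by rewrite e1 /wden /w21 /w22; ring.
have den0 : wden (a, b, c) x != 0 by rewrite hden !mulf_neq0.
split=> //; apply: (mulIf den0); rewrite /walk divfK // hden.
have -> : y * ((x + a) * (b - y1) * (x1 + c)) = (x + a) * (b - y1) * (y * (x1 + c)) by ring.
rewrite e3.
have -> : (x + a) * (b - y1) * (c * (x1 + tau * c)) =
   c * (x + a) * ((b * x1 - y1 * x1) + (b - y1) * (tau * c)) by ring.
rewrite e2'.
have -> : c * (x + a) * (y1 * b - tau * b ^+ 2 + (b - y1) * (tau * c)) =
   c * ((b - tau * c) * (y1 * (x + a)) + (x + a) * (b * (tau * c) - tau * b ^+ 2)) by ring.
by rewrite e1 /wnum /w11 /w12; ring.
Qed.

Lemma hom_edge_inj x x' a y : a != 0 -> hom_edge x a y -> hom_edge x' a y -> x = x'.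
Proof.
move=> a0 /andP[xa /eqP e1] /andP[xa' /eqP e2].
have h : a ^+ 2 * (tau - 1) * (x - x') = 0.
  have -> : a ^+ 2 * (tau - 1) * (x - x') =
     (a * (x' + tau * a)) * (x + a) - (a * (x + tau * a)) * (x' + a) by ring.
  by rewrite -e1 -e2; ring.
by move/eqP: h; rewrite !mulf_eq0 (negbTE a0) !subr_eq0 (negbTE tau1) /= => /eqP.
Qed.

Lemma hom_edge_fun x a y y' : hom_edge x a y -> hom_edge x a y' -> y = y'.
Proof. by move=> /andP[xa /eqP e1] /andP[_ /eqP e2]; apply: (mulIf xa); rewrite e1. Qed.

(** In the coordinates [1 / (x - x0)] and [1 / (y - walk t x0)] the map fixes infinity, hence is
    affine. *)
Lemma walk_affine t x0 x : regular t -> x != x0 ->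
  wden t x0 != 0 -> wden t x != 0 ->
  (walk t x - walk t x0)^-1 =
    wden t x0 * w21 t / wdet t + wden t x0 ^+ 2 / wdet t / (x - x0).
Proof.
move=> /regular_wdet d0 xx0 D0 D1.
have xx : x - x0 != 0 by rewrite subr_eq0.
have -> : walk t x - walk t x0 = wdet t * (x - x0) / (wden t x * wden t x0).
  rewrite /walk -mulNr addf_div //; congr (_ / _).
  by rewrite /wnum /wden /wdet; ring.
rewrite invf_div; apply: (@mulIf _ (wdet t * (x - x0))); first by rewrite mulf_neq0.
rewrite divfK ?mulf_neq0 //.
have -> : wden t x = wden t x0 + w21 t * (x - x0) by rewrite /wden; ring.
by field; rewrite xx d0.
Qed.

(** An affine map preserves barycentric coordinates, and [l] is that of [z] relative to [z0] and
    [z1]; it does not depend on [t]. *)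
Lemma walk_barycentric t x0 z0 z1 z : regular t ->
  z0 != x0 -> z1 != x0 -> z != x0 -> z1 != z0 ->
  wden t x0 != 0 -> wden t z0 != 0 -> wden t z1 != 0 -> wden t z != 0 ->
  let l := ((z - x0)^-1 - (z0 - x0)^-1) / ((z1 - x0)^-1 - (z0 - x0)^-1) in
  (1 - l) * (walk t z0 - walk t x0)^-1 + l * (walk t z1 - walk t x0)^-1
    = (walk t z - walk t x0)^-1.
Proof.
move=> tr z0x z1x zx z10 D D0 D1 Dz l.
rewrite !walk_affine // /l.
have h : (z1 - x0)^-1 - (z0 - x0)^-1 != 0.
  by rewrite subr_eq0; apply: contra_neq z10 => /invr_inj/addIr.
move: h; move: (z1 - x0)^-1 (z0 - x0)^-1 (z - x0)^-1 => i1 i0 i h.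
by field; rewrite h regular_wdet.
Qed.

(** Cross-multiplying the two maps gives a quadratic with three distinct roots, so its coefficients
    vanish. The leading one yields the factor [l = w21 t' / w21 t]; the other two form a linear
    system for the remaining discrepancies, of determinant [wdet t] up to sign. *)
Lemma walk_proportional t t' x0 x1 x2 :
  regular t -> regular t' -> x0 != x1 -> x0 != x2 -> x1 != x2 ->
  (forall x, x \in [:: x0; x1; x2] ->
     [/\ wden t x != 0, wden t' x != 0 & walk t x = walk t' x]) ->
  exists l, [/\ w11 t' = l * w11 t, w12 t' = l * w12 t, w21 t' = l * w21 t
     & w22 t' = l * w22 t].
Proof.
move=> tr tr' x01 x02 x12 h.
have w0 : w21 t != 0 by move: tr; case: (t) => -[a b] c /and5P[_ _ _ _ /andP[]].
pose A := w11 t * w21 t' - w11 t' * w21 t.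
pose B := w11 t * w22 t' + w12 t * w21 t' - w11 t' * w22 t - w12 t' * w21 t.
pose C := w12 t * w22 t' - w12 t' * w22 t.
have root x : x \in [:: x0; x1; x2] -> A * x ^+ 2 + B * x + C = 0.
  move=> /h[D D' e]; have : wnum t x * wden t' x - wnum t' x * wden t x = 0.
    by apply/eqP; rewrite subr_eq0 -eqr_div // -/(walk t x) e.
  by move=> <-; rewrite /A /B /C /wnum /wden; ring.
have r0 := root x0 (mem_head _ _).
have r1 : A * x1 ^+ 2 + B * x1 + C = 0 by apply: root; rewrite !inE eqxx orbT.
have r2 : A * x2 ^+ 2 + B * x2 + C = 0 by apply: root; rewrite !inE eqxx !orbT.
have lin y z : y != z -> A * y ^+ 2 + B * y + C = 0 -> A * z ^+ 2 + B * z + C = 0 ->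
    A * (y + z) + B = 0.
  rewrite -subr_eq0 => yz ry rz; apply: (mulfI yz); rewrite mulr0 -[RHS](subrr 0).
  by rewrite -{1}ry -{1}rz; ring.
have s1 := lin _ _ x01 r0 r1; have s2 := lin _ _ x02 r0 r2.
have A0 : A = 0.
  apply: (@mulIf _ (x1 - x2)); first by rewrite subr_eq0.
  by rewrite mul0r -[RHS](subrr 0) -{1}s1 -{1}s2; ring.
have B0 : B = 0 by rewrite A0 mul0r add0r in s1.
have C0 : C = 0 by rewrite A0 B0 !mul0r !add0r in r0.
pose l := w21 t' / w21 t; exists l.
have e21 : w21 t' = l * w21 t by rewrite /l divfK.
have e11 : w11 t' = l * w11 t.
  apply: (mulIf w0); apply/eqP; rewrite -subr_eq0 -mulrA mulrCA -e21 -oppr_eq0 opprB.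
  by apply/eqP.
pose e := w22 t' - l * w22 t; pose f := w12 t' - l * w12 t.
have ef : w11 t * e - w21 t * f = 0.
  by rewrite -B0 /B /e /f e11 e21; ring.
have ef2 : w12 t * e - w22 t * f = 0 by rewrite -C0 /C /e /f; ring.
have d0 := regular_wdet tr.
have f0 : f = 0.
  apply: (mulfI d0); rewrite mulr0 -[RHS](mulr0 (w12 t)) -{1}ef.
  transitivity (w12 t * (w11 t * e - w21 t * f) - w11 t * (w12 t * e - w22 t * f)).
    by rewrite /wdet; ring.
  by rewrite ef ef2; ring.
have e0 : e = 0.
  apply: (mulfI d0); rewrite mulr0.
  transitivity (w22 t * (w11 t * e - w21 t * f) - w21 t * (w12 t * e - w22 t * f)).
    by rewrite /wdet; ring.
  by rewrite ef ef2; ring.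
by split=> //; apply/eqP; rewrite -subr_eq0; apply/eqP.
Qed.

(* With [p = a / b] and [q = b / c], the normalised entries [w22 / abc] and
   [w11 / abc] are affine functions of [(p - 1) (q - 1)] and of
   [(p - 1) (q - 1) / (p q)]; so they determine [{p, q}], and [w21 / abc]
   then fixes the scale. *)
Lemma card_normalised_fibre (S : {set F * F * F}) (k11 k22 k21 : F) :
  (forall t, t \in S -> [/\ regular t, w11 t = k11 * vol t, w22 t = k22 * vol t
     & w21 t = k21 * vol t]) -> (#|S| <= 2)%N.
Proof.
move=> hS; have [->|[t1 t1S]] := set_0Vmem S; first by rewrite cards0.
pose p t : F := t.1.1 / t.1.2; pose q t : F := t.1.2 / t.2.
have key t : t \in S -> [/\ p t != 1, q t != 1, p t != 0, q t != 0 &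
   [/\ 1 + tau * ((p t - 1) * (q t - 1) - 1) = k22,
     1 + tau * ((p t - 1) * (q t - 1) / (p t * q t) - 1) = k11,
     t.2 * k21 = 1 - tau / p t - (q t)^-1 + (p t * q t)^-1 & k21 != 0]].
  move=> /hS; case: t => -[a b] c [/and5P[a0 b0 c0 ab /andP[bc w0]]] e11 e22 e21.
  have v0 : vol (a, b, c) != 0 by rewrite /= !mulf_neq0.
  rewrite /p /q /= !mulf_neq0 ?invr_neq0 //.
  split=> //.
  - by rewrite -subr_eq0 -(mulfK b0 1) mul1r -mulrBl mulf_neq0 ?invr_neq0 // subr_eq0.
  - by rewrite -subr_eq0 -(mulfK c0 1) mul1r -mulrBl mulf_neq0 ?invr_neq0 // subr_eq0.
  split.
  - apply: (mulIf v0); rewrite -e22 /vol /w22; field; by rewrite ?a0 ?b0 ?c0.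
  - apply: (mulIf v0); rewrite -e11 /vol /w11; field; by rewrite ?a0 ?b0 ?c0.
  - have -> : k21 = w21 (a, b, c) / vol (a, b, c) by rewrite e21 mulfK.
    rewrite /w21 /vol; field; by rewrite ?a0 ?b0 ?c0.
  - by apply: contraNneq w0 => k0; rewrite e21 k0 mul0r.
have pq t : t \in S -> p t * q t = p t1 * q t1 /\ p t + q t = p t1 + q t1.
  move=> tS; have [p1 q1 p0 q0 [h22 h11 _ _]] := key _ tS.
  have [p1' q1' p0' q0' [h22' h11' _ _]] := key _ t1S.
  have eE : (p t - 1) * (q t - 1) = (p t1 - 1) * (q t1 - 1).
    by move: h22; rewrite -h22' => /addrI/(mulfI tau0)/addIr.
  have E0 : (p t - 1) * (q t - 1) != 0 by rewrite mulf_neq0 ?subr_eq0.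
  have ePQ : p t * q t = p t1 * q t1.
    move: h11; rewrite -h11' => /addrI/(mulfI tau0)/addIr.
    by rewrite -eE => /(mulfI E0)/invr_inj.
  split=> //.
  have -> : p t + q t = p t * q t + 1 - (p t - 1) * (q t - 1) by ring.
  by rewrite ePQ eE; ring.
have injp : {in S &, injective p}.
  move=> t t' tS tS' ep; have [e1 _] := pq _ tS; have [e2 _] := pq _ tS'.
  have [_ _ p0 q0 [_ _ h k0]] := key _ tS; have [_ _ _ _ [_ _ h' _]] := key _ tS'.
  have eq : q t = q t' by apply: (mulfI p0); rewrite e1 -e2 ep.
  have ec : t.2 = t'.2 by apply: (mulIf k0); rewrite h h' ep eq.
  move: (hS _ tS) (hS _ tS') ep eq ec; case: t {tS e1 p0 q0 h} => -[a b] c.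
  case: t' {tS' e2 h'} => -[a' b'] c' [/and5P[a0 b0 c0 _ _] _ _ _] [/and5P[a0' b0' c0' _ _] _ _ _].
  rewrite /p /q /= => ep eq ec; rewrite -ec in eq *.
  have eb : b = b' by apply: (mulIf (invr_neq0 c0)).
  by rewrite -eb in ep *; rewrite (mulIf (invr_neq0 b0) ep).
rewrite -(card_in_imset injp); apply: leq_trans (subset_leq_card (_ : _ \subset [set p t1; q t1])) _.
  apply/subsetP => _ /imsetP[t tS ->]; have [e1 e2] := pq _ tS.
  have : (p t - p t1) * (p t - q t1) = 0.
    have -> : (p t - p t1) * (p t - q t1) = p t ^+ 2 - p t * (p t1 + q t1) + p t1 * q t1 by ring.
    by rewrite -e1 -e2; ring.
  by move/eqP; rewrite mulf_eq0 !subr_eq0 !inE.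
by rewrite cards2; case: (_ != _).
Qed.

(** Agreement at three points makes the matrices proportional, with factor [l]. Comparing
    determinants through [wdetE] gives [vol t = l * vol t0] up to sign. Each sign fixes the
    normalised entries and so leaves at most two labels. *)
Lemma card_walk_fibre (S : {set F * F * F}) x0 x1 x2 y0 y1 y2 :
  x0 != x1 -> x0 != x2 -> x1 != x2 ->
  (forall t, t \in S -> [/\ regular t,
     wden t x0 != 0 /\ walk t x0 = y0, wden t x1 != 0 /\ walk t x1 = y1
     & wden t x2 != 0 /\ walk t x2 = y2]) -> (#|S| <= 4)%N.
Proof.
move=> x01 x02 x12 hS; have [->|[t0 t0S]] := set_0Vmem S; first by rewrite cards0.
have [r0 [d00 e00] [d01 e01] [d02 e02]] := hS _ t0S.
have v0 := regular_vol r0.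
pose k (e : F) (w : F * F * F -> F) := e * (w t0 / vol t0).
pose Sg e := [set t in S | [&& w11 t == k e w11 * vol t, w22 t == k e w22 * vol t & w21 t == k e w21 * vol t]].
have cSg e : (#|Sg e| <= 2)%N.
  apply: (@card_normalised_fibre _ (k e w11) (k e w22) (k e w21)) => t.
  by rewrite inE => /andP[/hS[tr _ _ _]] /and3P[/eqP ? /eqP ? /eqP ?].
have sub : S \subset Sg 1 :|: Sg (-1).
  apply/subsetP => t tS; have [r [d0 e0] [d1 e1] [d2 e2]] := hS _ tS.
  have [l [h11 h12 h21 h22]] : exists l, [/\ w11 t = l * w11 t0, w12 t = l * w12 t0,
      w21 t = l * w21 t0 & w22 t = l * w22 t0].
    apply: (walk_proportional r0 r x01 x02 x12) => x; rewrite !inE.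
    by case/or3P => /eqP ->; rewrite ?e00 ?e01 ?e02 ?e0 ?e1 ?e2.
  have sq : vol t ^+ 2 = (l * vol t0) ^+ 2.
    have t10 : (1 - tau) ^+ 3 != 0 by rewrite expf_neq0 // subr_eq0 eq_sym.
    apply: (mulfI t10); rewrite -wdetE exprMn mulrCA -wdetE.
    by rewrite /wdet h11 h12 h21 h22; ring.
  have hk (e : F) w : vol t = e * (l * vol t0) -> e * e = 1 -> w t = l * w t0 -> w t = k e w * vol t.
    move=> hv ee ->; rewrite hv /k.
    have -> : e * (w t0 / vol t0) * (e * (l * vol t0)) = (e * e) * (l * w t0) by field.
    by rewrite ee mul1r.
  move/eqP: sq; rewrite eqf_sqr !inE tS /= => /orP[]/eqP hv; apply/orP.
    by left; apply/and3P; split; apply/eqP/hk; rewrite ?mul1r.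
  by right; apply/and3P; split; apply/eqP/hk; rewrite ?mulN1r ?opprK.
apply: leq_trans (subset_leq_card sub) _.
have [le1 _] := leq_card_setU (Sg 1) (Sg (-1)).
by apply: leq_trans le1 (leq_add (cSg _) (cSg _)).
Qed.

End Walks.

(** * Counting three-step walks *)

Section WalkCounting.
Variables (F : finFieldType) (tau : F) (X A Y : {set F}) (n : nat).
Hypotheses (A0 : 0 \notin A) (An : (#|A| <= n)%N).
Implicit Types (a b c x y : F) (t : F * F * F).

Definition hom_edges := [set e : F * F * F |
  [&& e.1.1 \in X, e.1.2 \in A, e.2 \in Y & hom_edge tau e.1.1 e.1.2 e.2]].

Definition reach t := [set x in X | (wden tau t x != 0) && (walk tau t x \in Y)].

Definition labels := setX (setX A A) A.

Lemma neq0A a : a \in A -> a != 0.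
Proof. by apply: contraTneq => ->. Qed.

(** In each degenerate case two of the labels determine the third; [w21 t = 0] with [a != b] is
    solved for [c]. *)
Lemma card_irregular : (#|[set t in labels | ~~ regular tau t]| <= 3 * n ^ 2)%N.
Proof.
pose D := setX A A.
pose f1 (u : F * F) : F * F * F := (u.1, u.1, u.2).
pose f2 (u : F * F) : F * F * F := (u.1, u.2, u.2).
pose f3 (u : F * F) : F * F * F := (u.1, u.2, u.2 * (u.1 - tau * u.2) / (u.1 - u.2)).
have sub : [set t in labels | ~~ regular tau t] \subset f1 @: D :|: (f2 @: D :|: f3 @: D).
  apply/subsetP => -[[a b] c]; rewrite !inE /= => /andP[/andP[/andP[aA bA] cA]].
  rewrite (neq0A aA) (neq0A bA) (neq0A cA) /=.
  have [->|ab] /= := eqVneq a b.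
    by move=> _; rewrite (_ : (b, b, c) = f1 (b, c)) // imset_f // inE /= bA cA.
  have [->|bc] /= := eqVneq b c.
    by move=> _; rewrite (_ : (a, c, c) = f2 (a, c)) // [X in _ || (X || _)]imset_f ?orbT // inE /= aA cA.
  rewrite negbK subr_eq0 => /eqP h; apply/orP; right; apply/orP; right.
  have -> : (a, b, c) = f3 (a, b) by rewrite /f3 /= h mulfK // subr_eq0.
  by rewrite imset_f // inE /= aA bA.
have cD (f : F * F -> F * F * F) : (#|f @: D| <= n ^ 2)%N.
  by apply: leq_trans (leq_imset_card _ _) _; rewrite cardsX -mulnn leq_mul.
apply: leq_trans (subset_leq_card sub) _.
have [le1 _] := leq_card_setU (f1 @: D) (f2 @: D :|: f3 @: D).
have [le2 _] := leq_card_setU (f2 @: D) (f3 @: D).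
have := cD f1; have := cD f2; have := cD f3; lia.
Qed.

(** Count walks by their middle edge [e = (x1, b, y1)]: the first step is one of [SY y1], the last
    one of [SX x1]. A label with its starting point determines [y1], then [x1], so distinct middle
    edges give disjoint families [P e]. Edges with a factor below [n / (4 * K)] make up at most half
    of all; each other edge carries at least [(n / (4 * K)) ^ 2] walks. *)
Lemma sum_reach (K : nat) : tau != 1 -> (#|X| <= n)%N -> (#|Y| <= n)%N ->
  (n ^ 2 <= K * #|hom_edges|)%N ->
  (n ^ 4 <= 32 * K ^ 3 * \sum_(t in labels) #|reach t|)%N.
Proof.
move=> tau1 Xn Yn nE; set E := hom_edges.
pose SY y := [set u in setX X A | hom_edge tau u.1 u.2 y].
pose SX x := [set u in setX A Y | hom_edge tau x u.1 u.2].
pose f (e : F * F * F) (u : (F * F) * (F * F)) := ((u.1.2, e.1.2, u.2.1), u.1.1).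
pose P e := f e @: setX (SY e.2) (SX e.1.1).
have inSYX e u : u \in setX (SY e.2) (SX e.1.1) -> [/\ u.1.1 \in X, u.1.2 \in A,
    u.2.1 \in A, u.2.2 \in Y & hom_edge tau u.1.1 u.1.2 e.2 /\ hom_edge tau e.1.1 u.2.1 u.2.2].
  by rewrite !inE => /andP[/andP[/andP[-> ->] ->] /andP[/andP[-> ->] ->]].
have cP e : #|P e| = (#|SY e.2| * #|SX e.1.1|)%N.
  rewrite -cardsX; apply: card_in_imset => -[[x a] [c y]] [[x' a'] [c' y']].
  move=> /inSYX[_ _ _ _ /= [_ h]] /inSYX[_ _ _ _ /= [_ h']] [ea ec ex].
  by rewrite ea ex ec in h h' *; rewrite (hom_edge_fun h h').
pose G := [set w : (F * F * F) * F | (w.1 \in labels) && (w.2 \in reach w.1)].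
have cG : #|G| = (\sum_(t in labels) #|reach t|)%N.
  rewrite -sum1_card (partition_big fst (mem labels)) /=; last first.
    by move=> w; rewrite inE => /andP[].
  apply: eq_bigr => t tl; rewrite sum1dep_card.
  rewrite -(card_imset (mem (reach t)) (_ : injective (fun x => (t, x)))); last by move=> ? ? [].
  apply: eq_card => -[t' x]; rewrite !inE /=; apply/idP/imsetP.
    by move=> /andP[/andP[_ h] /eqP <-]; exists x; rewrite // inE.
  by move=> [x' h [-> ->]]; move: tl h; rewrite !inE eqxx andbT => -> ->.
have inE' e : e \in E -> [/\ e.1.1 \in X, e.1.2 \in A, e.2 \in Y & hom_edge tau e.1.1 e.1.2 e.2].
  by rewrite inE => /and4P.
have sumP : (\sum_(e in E) #|SY e.2| * #|SX e.1.1| <= \sum_(t in labels) #|reach t|)%N.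
  rewrite -cG; under eq_bigr => e _ do rewrite -cP.
  apply: sum_card_disjoint.
    move=> e /inE'[xX bA yY h]; apply/subsetP => _ /imsetP[u /inSYX[uX aA cA uY [h1 h2]] ->].
    have [d w] := hom_edge_walk tau1 (neq0A bA) h1 h h2.
    by rewrite !inE /= uX aA bA cA d w uY.
  move=> [[x1 b] y1] [[x1' b'] y1'] w /inE'[_ bA _ h] /inE'[_ _ _ h'].
  move=> /imsetP[u /inSYX[_ _ _ _ [h1 h2]] ->] /imsetP[u' /inSYX[_ _ _ _ [h1' h2']] [ea eb ec ex]].
  rewrite /= in h h' h1 h1' ea eb ec ex bA *.
  rewrite ex ea in h1; have ey := hom_edge_fun h1 h1'; subst y1' b'.
  by rewrite (hom_edge_inj tau1 (neq0A bA) h h').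
pose light1 := [set e in E | (4 * K * #|SY e.2| < n)%N].
pose light2 := [set e in E | (4 * K * #|SX e.1.1| < n)%N].
have l1 : (4 * K * #|light1| <= n ^ 2)%N.
  apply: leq_trans (@card_light _ _ E (fun e => e.2) Y (fun y => #|SY y|) _ _ _ _) _.
  - by move=> e /inE'[].
  - move=> y; have injf : {in [set e in E | e.2 == y] &, injective (fun e : F * F * F => e.1)}.
      by move=> [u v] [u' v']; rewrite !inE /= => /andP[_ /eqP ->] /andP[_ /eqP ->] ->.
    rewrite -(card_in_imset injf); apply: subset_leq_card; apply/subsetP => _ /imsetP[e + ->].
    by rewrite inE => /andP[/inE'[h1 h2 _ h] /eqP <-]; rewrite !inE h1 h2.
  - by rewrite -mulnn leq_mul2r Yn orbT.
have l2 : (4 * K * #|light2| <= n ^ 2)%N.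
  apply: leq_trans (@card_light _ _ E (fun e => e.1.1) X (fun y => #|SX y|) _ _ _ _) _.
  - by move=> e /inE'[].
  - move=> x; have injf : {in [set e in E | e.1.1 == x] &, injective (fun e : F * F * F => (e.1.2, e.2))}.
      by move=> [[x1 a] y] [[x2 a'] y']; rewrite !inE /= => /andP[_ /eqP ->] /andP[_ /eqP ->] [-> ->].
    rewrite -(card_in_imset injf); apply: subset_leq_card; apply/subsetP => _ /imsetP[e + ->].
    by rewrite inE => /andP[/inE'[_ h1 h2 h] /eqP <-]; rewrite !inE h1 h2.
  - by rewrite -mulnn leq_mul2r Xn orbT.
pose H := E :\: (light1 :|: light2).
have cH : (#|E| <= #|H| + (#|light1| + #|light2|))%N.
  rewrite -(cardsID (light1 :|: light2) E) addnC leq_add2l.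
  have [le1 _] := leq_card_setU light1 light2.
  by apply: leq_trans le1; apply: subset_leq_card; apply: subsetIr.
have nH : (n ^ 2 <= 2 * K * #|H|)%N.
  have : (K * #|E| <= K * (#|H| + (#|light1| + #|light2|)))%N by rewrite leq_mul2l cH orbT.
  rewrite -!mulnA in l1 l2 *; move: nE l1 l2; rewrite -/E !mulnDr.
  by move: (K * _)%N (K * _)%N (K * _)%N (K * _)%N (n ^ 2)%N; lia.
have h1 : (#|H| * n ^ 2 <= 16 * K ^ 2 * \sum_(t in labels) #|reach t|)%N.
  apply: leq_trans (leq_mul (leqnn _) sumP).
  rewrite [X in (_ <= _ * X)%N](big_setID (light1 :|: light2)) /= -/H.
  rewrite mulnDr; apply: leq_trans (leq_addl _ _).
  rewrite big_distrr /= -sum_nat_const; apply: leq_sum => e.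
  rewrite !inE negb_or => /andP[/andP[g1 g2] eE].
  rewrite !eE /= -!leqNgt in g1 g2.
  rewrite -mulnn; apply: leq_trans (leq_mul g1 g2) _.
  by rewrite -mulnn; move: #|SY _| #|SX _| => u v; lia.
have -> : (n ^ 4 = n ^ 2 * n ^ 2)%N by rewrite -expnD.
apply: leq_trans (leq_mul nH (leqnn _)) _; rewrite -mulnA.
apply: leq_trans (leq_mul (leqnn (2 * K)) h1) _.
by move: (\sum_(t in _) _)%N => S; rewrite !expnS expn0; lia.
Qed.

End WalkCounting.

(** * Growth for the one-parameter family *)

Local Open Scope nat_scope.

Lemma homogeneous_growth : exists C : nat, forall (F : finFieldType) (tau : F)
    (X A Y : {set F}) (n K : nat),
  (forall x : F, exists k : nat, x = k%:R%R) -> (tau != 0)%R -> (tau != 1)%R ->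
  0 < n -> 1 < K -> #|X| <= n -> #|A| <= n -> #|Y| <= n -> 0%R \notin A ->
  n ^ 2 <= K * #|hom_edges tau X A Y| ->
  n <= K ^ C \/ #|F| <= K ^ C * n.
Proof.
have [D HD] := affine_combinations_growth.
(* The losses below total [2 ^ 41 * K ^ 15], at most [K ^ 56]; the 13 covers small [n], as
   [768 * K ^ 3 <= 2 ^ 10 * K ^ 3]. *)
exists (56 * D + 13) => F tau X A Y n K gen tau0 tau1 n0 K1 Xn An Yn A0 nE.
have K0 : 0 < K by apply: ltnW.
have powK a b k : a + b <= k -> 2 ^ a * K ^ b <= K ^ k.
  move=> ab; apply: leq_trans (leq_pexp2l K0 ab); rewrite expnD leq_mul2r.
  by case: (a) => [|a']; rewrite ?orbT // leq_exp2r ?K1 ?orbT.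
(* For larger [n] the irregular labels are negligible, and removing three points from a [reach] of
   size [n / (128 * K ^ 3)] costs at most half of it. *)
have [small|large] := ltnP n (768 * K ^ 3).
  left; apply: leq_trans (ltnW small) (leq_trans _ (leq_trans (powK 10 3 13 _) _)) => //.
    by rewrite leq_mul2r orbT.
  by rewrite leq_pexp2l // leq_addl.
suff : n <= (K ^ 56) ^ D \/ #|F| <= (K ^ 56) ^ D * n.
  rewrite -expnM => -[h|h]; [left|right]; apply: leq_trans h _; rewrite ?leq_mul2r;
    by rewrite leq_pexp2l ?leq_addr ?orbT.
pose R := reach tau X Y; pose labs := labels A.
have Rn t : #|R t| <= n.
  by apply: leq_trans Xn; apply: subset_leq_card; apply/subsetP => x; rewrite inE => /andP[].
pose PT := [set t in [set t in labs | regular tau t] | n <= 128 * K ^ 3 * #|R t|].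
have hPT : n ^ 3 <= 128 * K ^ 3 * #|PT|.
  have sr := sum_reach A0 An tau1 Xn Yn nE.
  rewrite -/R -/labs (big_setID [set t in labs | regular tau t]) /= in sr.
  have eND : labs :&: [set t in labs | regular tau t] = [set t in labs | regular tau t].
    by apply/setIidPr/subsetP => t; rewrite inE => /andP[].
  rewrite {}eND in sr.
  have h1 : \sum_(t in labs :\: [set t in labs | regular tau t]) #|R t| <= 3 * n ^ 3.
    apply: (@leq_trans (3 * n ^ 2 * n)); last by rewrite -mulnA -expnSr.
    apply: leq_trans (leq_mul (card_irregular tau A0 An) (leqnn n)).
    rewrite -sum_nat_const big_mkcond [leqRHS]big_mkcond /=; apply: leq_sum => t _.
    have inS (q : pred (F * F * F)) : (t \in [set u in labs | q u]) = (t \in labs) && q t.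
      by rewrite in_set.
    rewrite in_setD !inS.
    by case: (t \in labs) (regular tau t) => [] [] //=; exact: Rn.
  have h2 : #|[set t in labs | regular tau t]| * n <= n ^ 4.
    rewrite (expnSr n 3) leq_mul2r; apply/orP; right.
    apply: (@leq_trans #|labs|).
      by apply: subset_leq_card; apply/subsetP => t; rewrite inE => /andP[].
    rewrite /labs /labels !cardsX !expnSr expn0 mul1n.
    by do 2 (apply: leq_mul => //).
  have h3 := sum_popular [set t in labs | regular tau t] (fun t => #|R t|) (128 * K ^ 3) n.
  rewrite -/PT in h3.
  have h4 : \sum_(t in PT) #|R t| <= #|PT| * n.
    by rewrite -sum_nat_const; apply: leq_sum.
  have h5 : 768 * K ^ 3 * n ^ 3 <= n ^ 4 by rewrite (expnS n 3) leq_mul2r large orbT.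
  rewrite -(leq_pmul2r n0) -expnSr.
  move: sr h1 h2 h3 h4 h5; set k3 := K ^ 3; set n3 := n ^ 3; set n4 := n ^ 4.
  set S1 := (\sum_(t in labs :\: _) _).
  set S2 := (\sum_(t in [set t in labs | regular tau t]) _).
  set S3 := (\sum_(t in PT) _).
  clearbody k3 n3 n4 S1 S2 S3 => h6 h1 h2 h3 h4 h5.
  have g1 : k3 * S1 <= 3 * (k3 * n3) by rewrite mulnCA leq_mul2l h1 orbT.
  have g2 : k3 * S3 <= k3 * (#|PT| * n) by rewrite leq_mul2l h4 orbT.
  rewrite -!mulnA mulnDr in h3 h5 h6 *.
  move: g1 g2 h2 h3 h5 h6.
  move: (k3 * n3) (k3 * S1) (k3 * S2) (k3 * S3) (k3 * (#|PT| * n)).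
  move: (#|[set t in labs | _]| * n) => *.
  lia.
pose c := 256 * K ^ 3.
have inPT t : t \in PT -> regular tau t /\ n <= 128 * K ^ 3 * #|R t|.
  by rewrite inE => /andP[+ ->]; rewrite inE => /andP[_ ->].
have cPT t (Z : {set F}) : t \in PT -> #|Z| <= 3 -> R t \subset X /\ n <= c * #|R t :\: Z|.
  move=> /inPT[_ h] Z3; split; first by apply/subsetP => x; rewrite inE => /andP[].
  have h1 : #|R t| <= #|R t :\: Z| + 3.
    rewrite -(cardsID Z (R t)) addnC leq_add2l; apply: leq_trans Z3.
    exact: subset_leq_card (subsetIr _ _).
  have h2 : 128 * K ^ 3 * #|R t| <= 128 * K ^ 3 * (#|R t :\: Z| + 3).
    by rewrite leq_mul2l h1 orbT.
  move: (leq_trans h h2) large; rewrite /c; move: (K ^ 3) #|R t :\: Z| => k r.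
  rewrite -!mulnA mulnDr; lia.
have n3 : 0 < n ^ 3 by rewrite expn_gt0 n0.
have sel (P : {set F * F * F}) (Z : {set F}) m : P \subset PT -> n ^ 3 <= m * #|P| ->
    #|Z| <= 3 -> exists x, x \in X :\: Z /\ n ^ 3 <= m * c * #|[set t in P | x \in R t]|.
  move=> PPT mP Z3.
  have P0 : P != set0.
    by rewrite -card_gt0; move: mP; case: #|P| => //; rewrite muln0 leqNgt n3.
  have [x [xX hx]] := select_point n0 Xn P0 (fun t tP => cPT t Z (subsetP PPT t tP) Z3).
  by exists x; split=> //; apply: leq_trans mP _; rewrite -mulnA leq_mul2l hx orbT.
(* Three distinct base points are chosen in turn, each reached by a proportion [1 / c] of the labels
   still in play: [x0] is to become infinity, [z0] and [z1] the affine frame. *)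
have [|x0 [_ hx0]] := sel PT set0 _ (subxx _) hPT; first by rewrite cards0.
set P1 := [set t in PT | _] in hx0.
have P1PT : P1 \subset PT by apply/subsetP => t; rewrite inE => /andP[].
have [|z0 [z0X hz0]] := sel P1 [set x0] _ P1PT hx0; first by rewrite cards1.
set P2 := [set t in P1 | _] in hz0.
have P2P1 : P2 \subset P1 by apply/subsetP => t; rewrite inE => /andP[].
have Z2 : #|[set x0; z0]| <= 3 by rewrite cards2; case: (_ != _).
have [z1 [z1X hz1]] := sel P2 [set x0; z0] _ (subset_trans P2P1 P1PT) hz0 Z2.
set P3 := [set t in P2 | _] in hz1.
have inP3 t : t \in P3 -> [/\ t \in PT, x0 \in R t, z0 \in R t & z1 \in R t].
  by move=> /setIdP[/setIdP[/setIdP[]]].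
have inR t x : x \in R t -> [/\ x \in X, (wden tau t x != 0)%R & walk tau t x \in Y].
  by rewrite inE => /and3P.
have [y0 y0Y hy0] : exists2 y, y \in Y & #|P3| <= n * #|[set t in P3 | walk tau t x0 == y]|.
  apply: pigeonhole_sum => //.
    by rewrite card_gt0; apply: contraTneq hz1 => ->; rewrite cards0 muln0 -ltnNge.
  rewrite -[X in X <= _]sum1_card (partition_big (fun t => walk tau t x0) (mem Y)) /=; last first.
    by move=> t /inP3[_ /inR[]].
  by apply: leq_sum => y _; rewrite sum1dep_card.
set P4 := [set t in P3 | _] in hy0.
have z0x0 : z0 != x0 by move: z0X; rewrite !inE => /andP[].
have [z1x0 z1z0] : z1 != x0 /\ z1 != z0.
  by move: z1X; rewrite !inE negb_or => /andP[/andP[]].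
pose Z := [set x0; z0; z1].
have Z3 : #|Z| <= 3.
  by rewrite /Z setUC cardsU1 cards2; case: (_ \notin _) (_ != _) => [] [].
have hP4 : n ^ 2 <= 128 * K ^ 3 * c * c * c * #|P4|.
  rewrite -(leq_pmul2r n0) -expnSr; apply: leq_trans hz1 _.
  by rewrite -[leqRHS]mulnA leq_mul2l [#|P4| * n]mulnC hy0 orbT.
Local Open Scope ring_scope.
pose lam (z : F) := ((z - x0)^-1 - (z0 - x0)^-1) / ((z1 - x0)^-1 - (z0 - x0)^-1).
(* The value [y = y0] contributes 0, as [0^-1 = 0]; inversion is still an involution, so [y] can
   always be recovered. *)
pose W := [set (y - y0)^-1 | y in Y].
have memW y : y \in Y -> (y - y0)^-1 \in W by exact: (imset_f (fun y => (y - y0)^-1)).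
pose Lam := [set lam z | z in X :\: Z].
have Wn : (#|W| <= n)%N by apply: leq_trans (leq_imset_card _ _) Yn.
have dz : (z1 - x0)^-1 - (z0 - x0)^-1 != 0.
  by rewrite subr_eq0; apply: contra_neq z1z0 => /invr_inj/addIr.
have injlam : injective lam.
  by move=> z z' /(mulIf (invr_neq0 dz))/addIr/invr_inj/addIr.
have lam0 : lam z0 = 0 by rewrite /lam subrr mul0r.
have lam1 : lam z1 = 1 by rewrite /lam divff.
have Lamn : (#|Lam| <= n)%N.
  exact: leq_trans (leq_imset_card _ _) (leq_trans (subset_leq_card (subsetDl _ _)) Xn).
have notLam z : z \in Z -> lam z \notin Lam.
  by move=> zZ; apply/imsetP => -[z' + /injlam e]; rewrite -e inE zZ.
have Lam0 : 0 \notin Lam by rewrite -lam0 notLam // !inE eqxx orbT.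
have Lam1 : 1 \notin Lam by rewrite -lam1 notLam // !inE eqxx orbT.
pose g (l : F) := (\sum_(u in W) #|[set v in W | ((1 - l) * u + l * v)%R \in W]|)%N.
have inP4 t : t \in P4 -> t \in P3 /\ walk tau t x0 = y0.
  by rewrite inE => /andP[? /eqP].
(* The pair [f t] gives the images of [z0] and [z1], and that of [x0] is [y0], so at most four
   labels share it. By [walk_barycentric] the combination of this pair with parameter [lam z] comes
   from the image of [z] and lies in [W]. *)
have hg z : z \in X :\: Z -> (#|[set t in P4 | z \in R t]| <= 4 * g (lam z))%N.
  rewrite inE => /andP[zZ zX].
  have zx0 : z != x0 by move: zZ; rewrite !inE !negb_or => /andP[/andP[]].
  pose f t := ((walk tau t z0 - y0)^-1, (walk tau t z1 - y0)^-1).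
  apply: leq_trans (@card_le_fibres _ _ _ f 4 _) _.
    move=> s; apply: (@card_walk_fibre _ tau tau0 tau1 _ x0 z0 z1 y0 (y0 + s.1^-1) (y0 + s.2^-1));
      rewrite 1?eq_sym //.
    move=> t; rewrite inE => /andP[+ /eqP <-]; rewrite inE => /andP[/inP4[tP3 ty0] _].
    have [tPT /inR[_ d0 _] /inR[_ d1 _] /inR[_ d2 _]] := inP3 _ tP3.
    have [tr _] := inPT _ tPT.
    by rewrite /= !invrK ![y0 + _]addrC !subrK.
  rewrite leq_mul2l; apply/orP; right.
  have -> : g (lam z) = #|[set uv in setX W W | ((1 - lam z) * uv.1 + lam z * uv.2)%R \in W]|.
    rewrite /g card_sum_bool; under eq_bigr => u _ do rewrite card_sum_bool.
    by rewrite pair_big /=; apply: eq_bigl => -[u v]; rewrite in_setX.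
  apply: subset_leq_card; apply/subsetP => _ /imsetP[t + ->].
  rewrite inE => /andP[/inP4[tP3 ty0] /inR[_ dz' wz]].
  have [tPT /inR[_ d0 _] /inR[_ d1 w1] /inR[_ d2 w2]] := inP3 _ tP3.
  have [tr _] := inPT _ tPT.
  rewrite inE in_setX !memW //=.
  by rewrite -ty0 walk_barycentric // ty0 memW.
have sumg : (#|P4| * n <= c * (4 * \sum_(l in Lam) g l))%N.
  rewrite /Lam big_imset /=; last by move=> ? ? _ _; apply: injlam.
  apply: (@leq_trans (c * \sum_(z in X :\: Z) #|[set t in P4 | z \in R t]|)%N); last first.
    rewrite leq_mul2l; apply/orP; right; rewrite big_distrr /=.
    exact: leq_sum.
  under eq_bigr => z _ do rewrite card_sum_bool.
  rewrite exchange_big /= big_distrr -sum_nat_const /=; apply: leq_sum => t /inP4[tP3 _].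
  have [tPT _ _ _] := inP3 _ tP3; have [RX hR] := cPT _ _ tPT Z3.
  apply: leq_trans hR _; rewrite leq_mul2l -card_sum_bool; apply/orP; right.
  apply: subset_leq_card; apply/subsetP => z; rewrite [z \in [set _ in _ | _]]in_set !in_setD.
  by move=> /andP[-> zR]; rewrite zR (subsetP RX).
apply: (HD F W Lam) => //; first by apply: leq_trans K1 _; rewrite -[X in (X <= _)%N]expn1 leq_pexp2l.
rewrite expnSr; apply: leq_trans (leq_mul hP4 (leqnn n)) _.
rewrite -mulnA; apply: leq_trans (leq_mul (leqnn _) sumg) _.
rewrite [(c * (4 * _))%N]mulnA mulnA leq_mul2r; apply/orP; right.
apply: leq_trans (powK 41 15 56 _)%N => //; apply: eq_leq.
have collect (u v w k : nat) :
    (u * k * (v * k) * (v * k) * (v * k) * (v * k * w) = u * v ^ 4 * w * k ^ 5)%N.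
  by rewrite !expnS !expn0; ring.
have e : (2 ^ 7 * (2 ^ 8) ^ 4 * 2 ^ 2 = 2 ^ 41)%N by rewrite -expnM -!expnD.
by rewrite /c collect -e -(expnM K 3 5); congr (_ * _ ^ 4 * _ * _)%N.
Qed.

(** * Reduction to one parameter and choice of exponents *)

Local Open Scope ring_scope.

(* Rescaling [x] by [delta / gamma] and [y] by [delta / beta] leaves the single
   parameter [tau = alpha delta / (beta gamma)]. *)
Lemma NT_le_hom_edges (F : finFieldType) (alpha beta gamma delta : F) (V : {set F}) :
  alpha != 0 -> beta != 0 -> gamma != 0 -> delta != 0 ->
  (NT alpha beta gamma delta V <=
   #|hom_edges (alpha * delta / (beta * gamma)) (dilate (delta / gamma) V) V
       (dilate (delta / beta) V)|)%N.
Proof.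
move=> al0 be0 ga0 de0.
pose f (xa : F * F) := (delta / gamma * xa.1, xa.2,
  delta / beta * Tmap alpha beta gamma delta xa.2 xa.1).
have injf : injective f.
  move=> [x a] [x' a'] [/mulfI + -> _].
  by rewrite mulf_neq0 ?invr_neq0 // => /(_ isT) ->.
rewrite /NT -(card_imset _ injf); apply: subset_leq_card.
apply/subsetP => _ /imsetP[[x a] + ->]; rewrite inE /= => /and4P[xV aV d0 tV].
rewrite inE /= aV !mem_dilate //=.
have e : delta / gamma * x + a = (gamma * a + delta * x) / gamma by field.
apply/andP; split; first by rewrite e mulf_neq0 ?invr_neq0.
by apply/eqP; rewrite e /Tmap; field; rewrite ga0 be0 d0.
Qed.

(** The real exponent equals [(C + 1) / (2 * C + 1)], so raising to the power [2 * C + 1] gives an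
    inequality in [nat]. *)
Lemma powR_le_of_expn_le (R : realType) (C N n : nat) :
  (N ^ C.+1 <= 3 ^ C * n ^ (2 * C).+1)%N ->
  3^-1 * N%:R `^ (2^-1 + (2 * (2 * C).+1%:R)^-1) <= n%:R :> R.
Proof.
move=> le; rewrite mulrC ler_pdivrMr ?ltr0n //.
set e := (X in _ `^ X).
have eE : e * (2 * C).+1%:R = C.+1%:R.
  have h : 2 * C%:R + 1 != 0 :> R by rewrite -natrM natr1 pnatr_eq0.
  by rewrite /e -!natr1 natrM; field; rewrite h.
rewrite -(@ler_pXn2r _ (2 * C).+1) ?nnegrE ?powR_ge0 ?mulr_ge0 //.
rewrite -powR_mulrn ?powR_ge0 // -powRrM eE powR_mulrn ?ler0n //.
rewrite -!natrM -!natrX ler_nat; apply: leq_trans le _.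
by rewrite expnMn mulnC leq_mul2l leq_pexp2l ?orbT //; lia.
Qed.

Theorem theorem1p3 (R : realType) :
  exists c eta : R,
    [/\ 0 < c, 0 < eta &
      forall (p : nat) (alpha beta gamma delta : 'F_p) (V : {set 'F_p}),
        prime p ->
        alpha != 0 -> beta != 0 -> gamma != 0 -> delta != 0 ->
        alpha * delta - beta * gamma != 0 ->
        0 \notin V ->
        c * (minn (NT alpha beta gamma delta V) p)%:R `^ (2^-1 + eta)
          <= #|V|%:R].
Proof.
have [C growth] := homogeneous_growth.
exists 3^-1, (2 * (2 * C).+1%:R)^-1; split.
- by rewrite invr_gt0 ltr0n.
- by rewrite invr_gt0 mulr_gt0 ?ltr0n.
move=> p alpha beta gamma delta V pp al0 be0 ga0 de0 det0 V0.
apply: powR_le_of_expn_le.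
set N := NT _ _ _ _ _; set n := #|V|; set N' := minn N p.
have Nn : (N <= n ^ 2)%N.
  rewrite /N /NT -mulnn -cardsX; apply: subset_leq_card; apply/subsetP => xa.
  by rewrite !inE => /and4P[-> ->].
have N'N : (N' <= N)%N by apply: geq_minl.
have N'n := leq_trans N'N Nn.
have [->|N'0] := posnP N'; first by rewrite exp0n.
have n0 : (0 < n)%N by move: (leq_trans N'0 N'n); rewrite expn_gt0 orbF.
(* The summand 2 gives [K >= 2] and absorbs the rounding, while [N' <= n ^ 2] keeps [K * N'] below
   [3 * n ^ 2]. *)
pose K := (n ^ 2 %/ N' + 2)%N.
have K1 : (1 < K)%N by rewrite /K addn2.
have nK : (n ^ 2 <= K * N')%N.
  by rewrite {1}(divn_eq (n ^ 2) N') /K mulnDl leq_add2l; have := ltn_pmod (n ^ 2) N'0; lia.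
have Kn : (K * N' <= 3 * n ^ 2)%N.
  by rewrite /K mulnDl; have := leq_divM (n ^ 2) N'; lia.
have cF : #|'F_p| = p by apply: card_Fp.
have gen (x : 'F_p) : exists k : nat, x = k%:R by exists x; rewrite natr_Zp.
have tau0 : alpha * delta / (beta * gamma) != 0 by rewrite !mulf_neq0 ?invr_neq0 ?mulf_neq0.
have tau1 : alpha * delta / (beta * gamma) != 1.
  apply: contra_neq det0 => h; apply/eqP; rewrite subr_eq0; apply/eqP.
  by rewrite -[LHS](divfK (mulf_neq0 be0 ga0)) h mul1r.
have nE : (n ^ 2 <= K * #|hom_edges (alpha * delta / (beta * gamma))
    (dilate (delta / gamma) V) V (dilate (delta / beta) V)|)%N.
  apply: leq_trans nK _; rewrite leq_mul2l (leq_trans N'N) ?orbT //.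
  exact: NT_le_hom_edges.
have bound : (N' ^ C * K ^ C <= 3 ^ C * n ^ (2 * C))%N.
  rewrite -expnMn mulnC expnM -expnMn; case: (C) => // k.
  by rewrite leq_exp2r.
have := growth _ _ _ _ _ n K gen tau0 tau1 n0 K1 (card_dilate_le _ _) (leqnn n)
  (card_dilate_le _ _) V0 nE.
(* If [n <= K ^ C], multiply the goal by [n] and replace one factor [n] by [K ^ C]; if
   [p <= K ^ C * n], use [N' <= p] for one factor [N']. Either way [bound] absorbs [K ^ C]. *)
rewrite cF => -[nle|ple].
  rewrite -(leq_pmul2r n0) expnSr.
  apply: (@leq_trans (N' ^ C * K ^ C * n ^ 2)%N).
    by rewrite -mulnA -[leqRHS]mulnA leq_mul2l mulnC leq_mul ?orbT.
  apply: leq_trans (leq_mul bound (leqnn _)) _.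
  by rewrite -!mulnA -expnSr -expnD addn2.
rewrite expnSr; apply: leq_trans (leq_mul (leqnn _) (leq_trans (geq_minr N p) ple)) _.
by rewrite mulnA expnSr mulnA leq_mul2r bound orbT.
Qed.
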